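(* Let $n\ge3$, let $k$ be a real constant, let $\beta>n-1$ be fixed, let $f\in L^\infty(\mathbb{R}^{n-1})$, and let $$u(x)=k\int_{\mathbb{R}^{n-1}}\left(\frac{x_n^{\alpha}}{|y-x|}\right)^{\beta} f(y')\,dy',\qquad x\in\mathbb{R}^n_+,\ y=(y',0).$$ Let $x$ be an arbitrary point in $\mathbb{R}^n_+$. Let $\alpha_n(\beta)$ be the root from the interval $(1,+\infty)$ of the equation $$\frac{2\,\Gamma\left(\frac{\beta-n}{2}+1\right)}{\sqrt{\pi}\,\big(\beta(\alpha-1)+n-1\big)\,\Gamma\left(\frac{\beta-n+1}{2}\right)}=\frac{\alpha-1}{1+\sqrt{1+(\alpha-1)^2}}$$ with respect to $\alpha$. If $\alpha\ge\alpha_n(\beta)$, then the sharp coefficient $\mathcal{C}_{\alpha,\beta,\infty}(x)$ in the inequality $$|\nabla u(x)|\le\mathcal{C}_{\alpha,\beta,\infty}(x)\,\|f\|_\infty$$ is given by $$\mathcal{C}_{\alpha,\beta,\infty}(x)=\frac{C_{\alpha,\beta,\infty}}{x_n^{\,2-n+\beta(1-\alpha)}},$$ where $$C_{\alpha,\beta,\infty}=|k|\,\frac{\pi^{(n-1)/2}\,\Gamma\left(\frac{\beta-n+1}{2}\right)}{\Gamma\left(\frac{\beta}{2}\right)}\,\big((\alpha-1)\beta+n-1\big).$$ Under these conditions, the absolute value of the derivative of $u$ with respect to the normal to the boundary of the half-space at any $x\in\mathbb{R}^n_+$ has the same supremum as $|\nabla u(x)|$.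
   Context: $\mathbb{R}^n_+=\{x=(x',x_n):x'\in\mathbb{R}^{n-1},\ x_n>0\}$. $\|\cdot\|_\infty$ is the norm of $L^\infty(\mathbb{R}^{n-1})$ (real-valued functions). ''Sharp coefficient'' at a given $x$ means the smallest constant for which the inequality holds for all $f\in L^\infty(\mathbb{R}^{n-1})$. The derivative with respect to the normal is $\partial u/\partial x_n$, and the suprema are over all $f$ with $\|f\|_\infty\le1$; i.e. the last assertion says the same coefficient is sharp in $|\partial u(x)/\partial x_n|\le\mathcal{C}_{\alpha,\beta,\infty}(x)\|f\|_\infty$. *)

(* Defs.v *)
From HB Require Import structures.
From mathcomp Require Import all_boot all_order all_algebra.
From mathcomp Require Import all_classical all_reals all_analysis.

Set Implicit Arguments.
Unset Strict Implicit.
Unset Printing Implicit Defensive.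
Import Order.TTheory GRing.Theory Num.Theory.
Import numFieldNormedType.Exports.
Local Open Scope classical_set_scope.
Local Open Scope ring_scope.

(* MathComp-Analysis has Lebesgue measure on R and binary products of measures
   only. Lebesgue measure on R^d, carried by d.-tuple R with its product (Borel)
   sigma-algebra, is obtained by iterating the product along
   R * R^d ~ R^(d+1), (a, t) |-> a :: t. *)
Section lebesgue_tuple.
Context {R : realType}.
Local Notation T := (measurableTypeR R).

Definition consT d (p : T * d.-tuple T) : d.+1.-tuple T := [tuple of p.1 :: p.2].

Lemma measurable_consT d : measurable_fun setT (@consT d).
Proof. apply: measurable_cons; [exact: measurable_fst|exact: measurable_snd]. Qed.

Section step.
Context d (mu : {sigma_finite_measure set (d.-tuple T) -> \bar R}).

Definition leb_cons : set (d.+1.-tuple T) -> \bar R :=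
  pushforward (lebesgue_measure \x mu)%E (@consT d).

Let leb_cons0 : leb_cons set0 = 0%E.
Proof. by rewrite /leb_cons /pushforward preimage_set0 measure0. Qed.

Let leb_cons_ge0 A : (0 <= leb_cons A)%E.
Proof. by rewrite /leb_cons /pushforward measure_ge0. Qed.

Let leb_cons_sigma_additive : semi_sigma_additive leb_cons.
Proof.
move=> F mF tF mUF; rewrite /leb_cons /pushforward preimage_bigcup.
apply: measure_semi_sigma_additive.
- by move=> n; rewrite -[X in measurable X]setTI; exact: measurable_consT.
- apply/trivIsetP => /= i j _ _ ij; rewrite -preimage_setI.
  by move/trivIsetP : tF => /(_ _ _ _ _ ij) ->//; rewrite preimage_set0.
- by rewrite -preimage_bigcup -[X in measurable X]setTI; exact: measurable_consT.
Qed.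

HB.instance Definition _ := isMeasure.Build _ _ _
  leb_cons leb_cons0 leb_cons_ge0 leb_cons_sigma_additive.

Let leb_cons_sigma_finite : sigma_finite setT leb_cons.
Proof.
have /sigma_finiteP[F [FT ndF Foo]] := sigma_finiteT (@lebesgue_measure R).
have /sigma_finiteP[G [GT ndG Goo]] := sigma_finiteT mu.
pose g (t : d.+1.-tuple T) : T * d.-tuple T := (thead t, [tuple of behead t]).
have mg : measurable_fun setT g.
  apply: measurable_fun_pair; last exact: measurable_behead.
  exact: measurable_tnth.
have Kg p : g (consT p) = p.
  by case: p => a b; congr pair; apply: val_inj.
exists (fun i => g @^-1` (F i `*` G i)).
  apply/seteqP; split=> // t _.
  have : [set: T] (g t).1 by [].
  have : [set: d.-tuple T] (g t).2 by [].
  rewrite FT GT => -[j _ Gj] [i _ Fi]; exists (maxn i j) => //; split.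
  - by move: Fi; exact/subsetPset/ndF/leq_maxl.
  - by move: Gj; exact/subsetPset/ndG/leq_maxr.
move=> i; have [mF Fi] := Foo i; have [mG Gi] := Goo i; split.
  by rewrite -[X in measurable X]setTI; apply: mg => //; exact: measurableX.
rewrite /leb_cons /pushforward (_ : _ @^-1` _ = F i `*` G i); last first.
  by apply/funext => p; rewrite -[RHS](congr1 (F i `*` G i) (Kg p)).
by rewrite product_measure1E// lte_mul_pinfty// ge0_fin_numE.
Qed.

HB.instance Definition _ :=
  Measure_isSigmaFinite.Build _ _ _ leb_cons leb_cons_sigma_finite.

End step.

Fixpoint lebesgue_tuple d : {sigma_finite_measure set (d.-tuple T) -> \bar R} :=
  match d with
  | 0 => \d_ [tuple]
  | d'.+1 => leb_cons (lebesgue_tuple d')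
  end.

End lebesgue_tuple.

Definition Gamma {R : realType} (s : R) : R :=
  \int[lebesgue_measure]_(t in `]0, +oo[) (t `^ (s - 1) * expR (- t)).

Section euclidean.
Context {R : realType}.

(* The library norm on 'rV[R]_m is the sup norm; |.| here is Euclidean. *)
Definition enorm m (v : 'rV[R]_m) : R := Num.sqrt (\sum_i v 0 i ^+ 2).

Definition gradient m (u : 'rV[R]_m -> R) (x : 'rV[R]_m) : 'rV[R]_m :=
  \row_i 'D_(delta_mx 0 i) u x.

End euclidean.

(* For n >= 1, R^n is 'rV[R]_(n.-1 + 1): a point is x = (x', x_n) with x' in
   R^(n-1), and the last index is rshift n.-1 0. *)
Section half_space.
Context {R : realType} (n : nat).
Local Notation mu := (@lebesgue_tuple R n.-1).
Local Notation bfun := (n.-1.-tuple (measurableTypeR R) -> R).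

Definition normal_coord (x : 'rV[R]_(n.-1 + 1)) : R := x 0 (rshift n.-1 0).

Definition normal_derivative (u : 'rV[R]_(n.-1 + 1) -> R) x : R :=
  'D_(delta_mx 0 (rshift n.-1 0)) u x.

Definition half_space : set 'rV[R]_(n.-1 + 1) := [set x | 0 < normal_coord x].

Definition boundary_point (y : n.-1.-tuple (measurableTypeR R)) :
  'rV[R]_(n.-1 + 1) := row_mx (\row_i tnth y i) 0.

Definition potential (k alpha beta : R) (f : bfun) (x : 'rV[R]_(n.-1 + 1)) : R :=
  k * \int[mu]_y
        ((normal_coord x `^ alpha / enorm (boundary_point y - x)) `^ beta * f y).

Definition is_alpha_n (beta a : R) : Prop :=
  1 < a /\
  2 * Gamma ((beta - n%:R) / 2 + 1) /
    (Num.sqrt pi * (beta * (a - 1) + n%:R - 1) * Gamma ((beta - n%:R + 1) / 2))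
  = (a - 1) / (1 + Num.sqrt (1 + (a - 1) ^+ 2)).

(* Q f stands for |grad u(x)| or |du/dx_n (x)|, with u the potential of f. *)
Definition sharp_coefficient (Q : bfun -> R) (C : R) : Prop :=
  let admissible := [set c : R | forall f : bfun, f \in Lfun mu +oo%E ->
    ((Q f)%:E <= c%:E * 'N[mu]_+oo [EFin \o f])%E] in
  admissible C /\ lbound admissible C.

Definition unit_ball_sup (Q : bfun -> R) : \bar R :=
  ereal_sup [set (Q f)%:E | f in
    [set f : bfun | f \in Lfun mu +oo%E /\ ('N[mu]_+oo [EFin \o f] <= 1)%E]].

Definition C_infty (k alpha beta : R) : R :=
  `|k| * (pi `^ ((n%:R - 1) / 2) * Gamma ((beta - n%:R + 1) / 2)
            / Gamma (beta / 2))
       * ((alpha - 1) * beta + n%:R - 1).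

End half_space.

Arguments potential {R} n k alpha beta f x.
Arguments is_alpha_n {R} n beta a.
Arguments sharp_coefficient {R} n Q C.
Arguments unit_ball_sup {R} n Q.
Arguments C_infty {R} n k alpha beta.

(* Main.v *)
Require Import Defs.
From mathcomp Require Import all_boot all_order all_algebra.
From mathcomp Require Import all_classical all_reals all_analysis.
From mathcomp Require Import measurable_realfun ess_sup_inf ring lra.
Import Order.TTheory GRing.Theory Num.Theory.
Import numFieldNormedType.Exports.
Local Open Scope classical_set_scope.
Local Open Scope ring_scope.

(** Put c = x_n, w = x' - y, r^2 = c^2 + |w|^2 and d = n - 1. The derivative at x
of the kernel (x_n^alpha / |y - x|)^beta in the direction v = (v', v_n) is

  beta c^(alpha beta - 1) [v_n (alpha r^2 - c^2) - c (v' . w)] r^(- beta - 2).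

The length of the gradient of u is its largest directional derivative, and f
ranges over a unit ball of L^oo, so the sharp coefficient at x is |k| times the
largest L^1 norm of this kernel over unit vectors v. For v = e_n the kernel is
nonnegative, because alpha >= 1; its integral, up to the factor
beta c^(alpha beta - 1), is an explicit mass M ([Rintegral_normal_kernel]) and
f = 1 is extremal. What has to be shown is that no other direction does better
([Rintegral_gradient_kernel_le]).

- If |v'| <= (alpha - 1) |v_n|, the normal part of the bracket dominates the
  tangential part pointwise ([norm_dot_tuple_le]). The kernel then has a constant
  sign, and its tangential part, odd in w, integrates to 0: the norm is |v_n| M.
- Otherwise the triangle inequality bounds the norm by |v_n| M + |v'| B, where B is
  the mass of the tangential part for |v'| = 1 ([Rintegral_norm_dot]). With
  |v_n| = cos g and |v'| = sin g this is at most M as soon as B / M <= tan (g / 2).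
  Here tan g > alpha - 1, so it is enough that
  B / M <= tan (arctan (alpha - 1) / 2)
         = (alpha - 1) / (1 + sqrt (1 + (alpha - 1)^2)) ([half_angle_le]).

The quotient B / M is the left-hand side of the equation that defines alpha_n. It
decreases with alpha whereas the right-hand side increases, so the last inequality
holds for all alpha >= alpha_n ([alpha_n_ratio]); the same monotonicity and the
intermediate value theorem give the existence and uniqueness of alpha_n
([exists_unique_alpha_n]).

Both M and B come from the subordination identity
Gamma s r^(- 2 s) = int_0^oo t^(s - 1) exp (- t r^2) dt, which turns radial
integrals over R^d into Gaussian ones. For a Gaussian weight a linear form
a . y is distributed like |a| times one Gaussian variable
([integral_gauss_direction]); this is proved one coordinate at a time by completing
a square in the plane, so that no change of variables in R^d is needed beyond the
maps y |-> c - y ([integral_radial_direction]).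

The potential itself is differentiated under the integral sign
([is_derive_potential]): along a line the squared distance is a quadratic
polynomial, and for small steps the derivative of the kernel is dominated by a
multiple of its value at the starting point ([kernel_line_bound]). *)

(** * Integrals over the line *)

Section one_dim.
Context {R : realType}.
Local Notation leb := (@lebesgue_measure R).

Lemma measurable_affine (a b : R) :
  measurable_fun setT (fun x : R => a * x + b : measurableTypeR R)%R.
Proof. by apply: measurable_funD => //; exact: measurable_funM. Qed.

Lemma preimage_affine (a b x y : R) : a != 0%R ->
  (fun t : R => a * t + b)%R @^-1` `]x, y]%classic =
  if (0 < a)%R then `](x - b) / a, (y - b) / a]%classic
  else `[(y - b) / a, (x - b) / a[%classic.
Proof.
move=> a0; case: ltP => [a_gt0|a_le0].
  apply/seteqP; split => t /=;
    by rewrite !in_itv/= ltr_pdivrMr// ler_pdivlMr// (mulrC t) ltrBlDr lerBrDr.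
have a_lt0 : (a < 0)%R by rewrite lt_neqAle a0.
by apply/seteqP; split => t /=; rewrite !in_itv/= ltr_ndivlMr// ler_ndivrMr//
  (mulrC t) ltrBlDr lerBrDr andbC.
Qed.

(** Lebesgue measure is determined by its values on half-open intervals, where the
scaling is read off from the length. *)
Lemma lebesgue_measure_affine (a b : R) (A : set (measurableTypeR R)) :
  a != 0%R -> measurable A ->
  leb A = (`|a|%:E * pushforward leb (fun t : R => (a * t + b)%R : measurableTypeR R) A)%E.
Proof.
move=> a0 mA.
pose f := fun t : measurableTypeR R => (a * t + b : measurableTypeR R)%R.
have mf : measurable_fun setT f by exact: measurable_affine.
pose push : {measure set (measurableTypeR R) -> \bar R} :=
  measure_function_pushforward__canonical__measure_function_Measure leb mf.
pose nu : {measure set (measurableTypeR R) -> \bar R} :=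
  mscale (NngNum (normr_ge0 a)) push.
suff : forall A, measurable A -> leb A = nu A by apply.
apply: lebesgue_measure_unique => _ [[x y] _ <-] /=.
rewrite /nu/mscale/= /pushforward preimage_affine//.
case: ifPn => [a_gt0|]; last first.
  rewrite -leNgt => a_le0; have a_lt0 : (a < 0)%R by rewrite lt_neqAle a0.
  rewrite !lebesgue_measure_itv/= !lte_fin ltr_ndivrMr// divfK// ltrBlDr subrK.
  case: ifPn => _; last by rewrite mule0.
  rewrite !EFinN -!EFinD -EFinM ltr0_norm//; congr EFin; field; exact: a0.
rewrite !lebesgue_measure_itv/= !lte_fin ltr_pdivrMr// divfK// ltrBlDr subrK.
case: ifPn => _; last by rewrite mule0.
rewrite !EFinN -!EFinD -EFinM gtr0_norm//; congr EFin; field; exact: a0.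
Qed.

Lemma ge0_integral_affine (a b : R) (F : R -> \bar R) : a != 0%R ->
  measurable_fun setT F -> (forall x, 0 <= F x)%E ->
  (`|a|%:E * \int[leb]_x F (a * x + b)%R = \int[leb]_x F x)%E.
Proof.
move=> a0 mF F0.
pose f := fun t : measurableTypeR R => (a * t + b : measurableTypeR R)%R.
have mf : measurable_fun setT f by exact: measurable_affine.
pose push : {measure set (measurableTypeR R) -> \bar R} :=
  measure_function_pushforward__canonical__measure_function_Measure leb mf.
rewrite (_ : (fun x => F (a * x + b)%R) = F \o f)//.
have := @ge0_integral_pushforward _ _ _ _ _ f mf leb setT F measurableT mF.
rewrite preimage_setT => <-; last by move=> *; exact: F0.
rewrite -(@ge0_integral_mscale _ _ _ push setT measurableT (NngNum (normr_ge0 a)) F)//.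
apply: eq_measure_integral => A mA _.
by symmetry; apply: lebesgue_measure_affine.
Qed.

(** Every antiderivative used below extends smoothly across the left endpoint a, so
the conditions at a are of the same kind as those inside. *)
Lemma ge0_integral_antiderivative (f F : R -> R) (a l : R) :
  (forall x, a <= x -> is_derive x 1 F (f x)) ->
  (forall x, a <= x -> {for x, continuous f}) ->
  (forall x, a <= x -> 0 <= f x) ->
  F x @[x --> +oo] --> l ->
  (\int[leb]_(x in `[a, +oo[) (f x)%:E = (l - F a)%:E)%E.
Proof.
move=> dF cf f0 Fl; rewrite EFinB; apply: ge0_continuous_FTC2y => //.
- apply/continuous_within_itvcyP; split.
    by move=> x; rewrite in_itv/= andbT => /ltW; exact: cf.
  by apply: cvg_at_right_filter; exact: cf.
- by move=> x /ltW ax; have [] := dF x ax.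
- apply: cvg_at_right_filter; have [dFa _] := dF a (lexx a).
  exact/differentiable_continuous/derivable1_diffP.
- move=> x; rewrite in_itv/= andbT => /ltW ax.
  by rewrite derive1E; have [_ ->] := dF x ax.
Qed.

Lemma gt0_mul_powRB1 (a p : R) : 0 < a -> a * a `^ (p - 1) = a `^ p.
Proof.
move=> a0; rewrite powRB; last by rewrite (gt_eqF a0) implybT.
by rewrite (powRr1 (ltW a0)) mulrC divfK// gt_eqF.
Qed.

Lemma cvg_expRN_lin (c : R) : 0 < c -> expR (- (c * x)) @[x --> +oo] --> 0.
Proof.
move=> c0; apply: (@cvg_comp _ _ _ (fun x => c * x) (fun x => expR (- x)) _ (pinfty_nbhs R)).
  by apply: gt0_cvgMry => //; exact: cvg_id.
exact: cvgr_expR.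
Qed.

Lemma cvg_powRN (s : R) : 0 < s -> x `^ (- s) @[x --> +oo] --> 0.
Proof.
move=> s0; apply/cvgrPdist_le => e e0; near=> x.
have x0 : 0 < x by near: x; exact: nbhs_pinfty_gt.
rewrite sub0r normrN ger0_norm ?powR_ge0// powRN -[leRHS]invrK.
rewrite lef_pV2 ?posrE ?invr_gt0 ?powR_gt0//.
have -> : e^-1 = (e^-1 `^ s^-1) `^ s.
  by rewrite -powRrM mulVf ?gt_eqF// powRr1// invr_ge0 ltW.
apply: ge0_ler_powR; rewrite ?nnegrE ?powR_ge0 ?(ltW s0) ?(ltW x0)//.
Unshelve. all: end_near. Qed.

Lemma integral_expRN_itvcy (c a : R) : 0 < c ->
  (\int[leb]_(x in `[a, +oo[) (expR (- (c * x)))%:E = (expR (- (c * a)) / c)%:E)%E.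
Proof.
move=> c0.
pose F x := - c^-1 * expR (- (c * x)).
have -> : expR (- (c * a)) / c = - c^-1 * 0 - F a.
  by rewrite /F mulr0 sub0r mulNr opprK mulrC.
apply: ge0_integral_antiderivative.
- move=> x _; apply: is_derive_eq.
  by rewrite /GRing.scale/=; field; rewrite gt_eqF.
- move=> x _; apply: continuous_comp; last exact: continuous_expR.
  by apply: continuousN; apply: continuousM; [exact: cst_continuous|exact: cvg_id].
- by move=> x _; exact: expR_ge0.
- by apply: cvgMr; exact: cvg_expRN_lin.
Qed.

Lemma integral_powR_itv1y (s : R) : 0 < s ->
  (\int[leb]_(x in `[1%R, +oo[) (x `^ (- (s + 1)))%:E = (s^-1)%:E)%E.
Proof.
move=> s0.
pose F x := - s^-1 * x `^ (- s).
have -> : s^-1 = - s^-1 * 0 - F 1.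
  by rewrite /F powR1 mulr0 sub0r mulNr mulr1 opprK.
apply: ge0_integral_antiderivative.
- move=> x x1; have x0 : 0 < x by exact: lt_le_trans x1.
  have := is_derive1_powR (- s) x0 => dx.
  apply: is_derive_eq.
  rewrite /GRing.scale/= (_ : - s - 1 = - (s + 1)); last by rewrite opprD.
  by field; rewrite gt_eqF.
- move=> x x1; have x0 : 0 < x by exact: lt_le_trans x1.
  apply: differentiable_continuous; apply/derivable1_diffP.
  by have [] := is_derive1_powR (- (s + 1)) x0.
- by move=> x _; exact: powR_ge0.
- by apply: cvgMr; exact: cvg_powRN.
Qed.

Lemma ge0_integralZl_real d (T : measurableType d) (mu : {measure set T -> \bar R})
    (D : set T) (f : T -> R) (k : R) :
  measurable D -> measurable_fun setT f -> (forall x, 0 <= f x) -> 0 <= k ->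
  (\int[mu]_(x in D) (k * f x)%:E = k%:E * \int[mu]_(x in D) (f x)%:E)%E.
Proof.
move=> mD mf f0 k0; rewrite -ge0_integralZl_EFin//.
  by move=> x _; rewrite lee_fin.
by apply/measurable_EFinP; exact: measurable_funTS.
Qed.

(** Tonelli's theorem on a rectangle, by extending the integrand by 0. *)
Lemma ge0_fubini_set d1 d2 (T1 : measurableType d1) (T2 : measurableType d2)
    (m1 : {sigma_finite_measure set T1 -> \bar R})
    (m2 : {sigma_finite_measure set T2 -> \bar R})
    (A : set T1) (B : set T2) (f : T1 * T2 -> \bar R) :
  measurable A -> measurable B -> measurable_fun setT f -> (forall x, 0 <= f x)%E ->
  (\int[m1]_(x in A) \int[m2]_(y in B) f (x, y) =
   \int[m2]_(y in B) \int[m1]_(x in A) f (x, y))%E.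
Proof.
move=> mA mB mf f0.
pose g := f \_ (A `*` B).
have mg : measurable_fun setT g.
  by apply/(measurable_restrictT _ (measurableX mA mB)); exact: measurable_funS mf.
have g0 x : (0 <= g x)%E by rewrite /g patchE; case: ifPn.
transitivity (\int[m1]_x \int[m2]_y g (x, y))%E.
  rewrite integral_mkcond; apply: eq_integral => x _; rewrite patchE.
  case: ifPn => [xA|xA].
    rewrite integral_mkcond; apply: eq_integral => y _; rewrite /g !patchE.
    by rewrite in_setX/= xA.
  by rewrite integral0_eq// => y _; rewrite /g patchE in_setX/= (negbTE xA).
rewrite fubini_tonelli//.
symmetry; rewrite integral_mkcond; apply: eq_integral => y _; rewrite patchE.
case: ifPn => [yB|yB].
  rewrite integral_mkcond; apply: eq_integral => x _; rewrite /g !patchE.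
  by rewrite in_setX/= yB andbT.
by rewrite integral0_eq// => x _; rewrite /g patchE in_setX/= (negbTE yB) andbF.
Qed.

End one_dim.

(** * The Gamma function *)

Section gamma.
Context {R : realType}.
Local Notation leb := (@lebesgue_measure R).

Lemma ge0_integral_scale0y (c : R) (F : R -> \bar R) : 0 < c ->
  measurable_fun setT F -> (forall x, 0 <= F x)%E ->
  (c%:E * \int[leb]_(t in `]0%R, +oo[) F (c * t)%R =
   \int[leb]_(t in `]0%R, +oo[) F t)%E.
Proof.
move=> c0 mF F0; pose G := F \_ `]0, +oo[.
have mG : measurable_fun setT G.
  by apply/(measurable_restrictT F (measurable_itv _)); exact: measurable_funTS.
have G0 x : (0 <= G x)%E by rewrite /G patchE; case: ifPn.
rewrite [RHS]integral_mkcond -/G -(@ge0_integral_affine _ c 0 G)// ?gt_eqF//.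
rewrite (gtr0_norm c0); congr *%E.
rewrite integral_mkcond; apply: eq_integral => t _.
by rewrite /G !patchE !mem_setE !in_itv/= !andbT addr0 pmulr_rgt0.
Qed.

Definition gamma_fun (s t : R) : R := t `^ (s - 1) * expR (- t).

Lemma gamma_fun_ge0 s t : 0 <= gamma_fun s t.
Proof. by rewrite mulr_ge0 ?powR_ge0 ?expR_ge0. Qed.

Lemma measurable_gamma_fun s : measurable_fun setT (gamma_fun s).
Proof.
apply: measurable_funM; first exact: measurable_powR.
by apply: (@measurableT_comp _ _ _ _ _ _ expR) => //; exact: measurable_funN.
Qed.

(** The subordination identity: it writes any power of c as a mixture of the
exponentials t |-> exp (- c t). *)
Lemma integral_gamma_fun_scale (s c : R) : 0 < c ->
  (\int[leb]_(t in `]0%R, +oo[) (t `^ (s - 1) * expR (- (c * t)))%:E =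
   (c `^ (- s))%:E * \int[leb]_(t in `]0%R, +oo[) (gamma_fun s t)%:E)%E.
Proof.
move=> c0; rewrite -(@ge0_integral_scale0y c (fun t => (gamma_fun s t)%:E))//; first last.
- by move=> x; rewrite lee_fin gamma_fun_ge0.
- by apply/measurable_EFinP; exact: measurable_gamma_fun.
rewrite muleA -EFinM -ge0_integralZl_EFin//; first last.
- by rewrite mulr_ge0 ?powR_ge0 ?ltW.
- apply/measurable_EFinP/measurable_funTS.
  by apply: (measurableT_comp (measurable_gamma_fun s)); exact: measurable_funM.
- by move=> t _; rewrite lee_fin gamma_fun_ge0.
apply: eq_integral => t; rewrite inE/= in_itv/= andbT => t0; rewrite -EFinM.
congr EFin; rewrite /gamma_fun powRM ?(ltW c0) ?(ltW t0)//.
rewrite powRN -[in RHS](gt0_mul_powRB1 c s c0); field.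
by rewrite !gt_eqF ?powR_gt0.
Qed.

(** Integrating t^s exp (- c t) over t > 0 and c >= 1 in the two possible orders gives
Gamma s on one side and Gamma (s + 1) / s on the other. This avoids integrating by
parts at the singularity t = 0, and is valid in the extended reals, so that it can
serve to prove that Gamma is finite. *)
Lemma egammaS (s : R) : 0 < s ->
  (\int[leb]_(t in `]0%R, +oo[) (gamma_fun (s + 1) t)%:E =
   s%:E * \int[leb]_(t in `]0%R, +oo[) (gamma_fun s t)%:E)%E.
Proof.
move=> s0.
pose f (p : R * R) := (p.1 `^ s * expR (- (p.2 * p.1)))%:E.
have mf : measurable_fun setT f.
  apply/measurable_EFinP/measurable_funM.
    by apply: (@measurableT_comp _ _ _ _ _ _ (@powR R ^~ s)) => //; exact: measurable_powR.
  apply: (@measurableT_comp _ _ _ _ _ _ expR) => //; apply: measurable_funN.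
  by apply: measurable_funM; [exact: measurable_snd|exact: measurable_fst].
have f0 p : (0 <= f p)%E by rewrite lee_fin mulr_ge0 ?powR_ge0 ?expR_ge0.
have inner_c : (\int[leb]_(x in `]0%R, +oo[) \int[leb]_(y in `[1%R, +oo[) f (x, y) =
    \int[leb]_(t in `]0%R, +oo[) (gamma_fun s t)%:E)%E.
  apply: eq_integral => t; rewrite inE/= in_itv/= andbT => t0.
  rewrite /f/= ge0_integralZl_real ?powR_ge0//; first last.
    apply: (@measurableT_comp _ _ _ _ _ _ expR) => //.
    by apply: measurable_funN; exact: measurable_funM.
  under eq_integral do rewrite mulrC.
  rewrite integral_expRN_itvcy// -EFinM /gamma_fun powRB; last by rewrite (gt_eqF t0) implybT.
  by rewrite (powRr1 (ltW t0)) mulr1 mulrA mulrAC.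
have inner_t : (\int[leb]_(y in `[1%R, +oo[) \int[leb]_(x in `]0%R, +oo[) f (x, y) =
    (s^-1)%:E * \int[leb]_(t in `]0%R, +oo[) (gamma_fun (s + 1) t)%:E)%E.
  rewrite -(integral_powR_itv1y s s0) -ge0_integralZr//; first last.
  - by apply: integral_ge0 => t _; rewrite lee_fin gamma_fun_ge0.
  - by move=> x _; rewrite lee_fin powR_ge0.
  - by apply/measurable_EFinP/measurable_funTS; exact: measurable_powR.
  apply: eq_integral => c; rewrite inE/= in_itv/= andbT => c1.
  rewrite -(integral_gamma_fun_scale (s + 1) c (lt_le_trans ltr01 c1)).
  by apply: eq_integral => t _; rewrite addrK.
have swap := @ge0_fubini_set R _ _ _ _ leb leb `]0, +oo[ `[1, +oo[ f
  (measurable_itv _) (measurable_itv _) mf f0.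
rewrite (etrans (esym inner_c) (etrans swap inner_t)) muleA -EFinM.
by move=> {swap inner_c inner_t}; rewrite divff ?gt_eqF// mul1e.
Qed.

Lemma egamma1 : (\int[leb]_(t in `]0%R, +oo[) (gamma_fun 1 t)%:E = 1)%E.
Proof.
rewrite integral_itv_obnd_cbnd; last first.
  by apply/measurable_EFinP/measurable_funTS; exact: measurable_gamma_fun.
have := integral_expRN_itvcy (1 : R) 0 ltr01.
rewrite mulr0 oppr0 expR0 divr1 => <-; apply: eq_integral => t _.
by rewrite /gamma_fun subrr powRr0 !mul1r.
Qed.

Lemma egamma_nat n :
  (\int[leb]_(t in `]0%R, +oo[) (gamma_fun n.+1%:R t)%:E = n`!%:R%:E)%E.
Proof.
elim: n => [|n IHn]; first by rewrite egamma1.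
by rewrite -natr1 egammaS// IHn -EFinM -natrM factS.
Qed.

(** For r >= 1 the integrand is at most the sum of those of Gamma 1 and Gamma (n + 1)
with r <= n + 1, which are finite; the recursion brings 0 < s < 1 back to s + 1. *)
Lemma egamma_lty (s : R) : 0 < s ->
  (\int[leb]_(t in `]0%R, +oo[) (gamma_fun s t)%:E < +oo)%E.
Proof.
suff H r : 1 <= r -> (\int[leb]_(t in `]0%R, +oo[) (gamma_fun r t)%:E < +oo)%E.
  move=> s0; have := H (s + 1); rewrite lerDr (ltW s0) => /(_ isT).
  rewrite egammaS// => sI; apply: contraTT sI.
  rewrite -!leNgt !leye_eq => /eqP ->; by rewrite gt0_muley ?lte_fin.
move=> r1.
have mg q : measurable_fun setT (fun t => (gamma_fun q t)%:E).
  by apply/measurable_EFinP; exact: measurable_gamma_fun.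
have [n rn] : exists n, r <= n.+1%:R.
  by exists (Num.truncn r); rewrite ltW// truncnS_gt.
apply: (@le_lt_trans _ _ (\int[leb]_(t in `]0%R, +oo[)
  ((gamma_fun 1 t)%:E + (gamma_fun n.+1%:R t)%:E))%E).
  apply: ge0_le_integral => //.
  - by move=> t _; rewrite lee_fin gamma_fun_ge0.
  - exact: measurable_funTS (mg r).
  - by apply: measurable_funTS; apply: emeasurable_funD; exact: mg.
  - move=> t; rewrite /= in_itv/= andbT => t0; rewrite -EFinD lee_fin /gamma_fun.
    rewrite -mulrDl ler_wpM2r ?expR_ge0// subrr powRr0.
    have [t1|/ltW t1] := leP t 1.
      rewrite (@le_trans _ _ 1) ?lerDl ?powR_ge0//.
      rewrite [leRHS](_ : 1 = 1 `^ (r - 1)); last by rewrite powR1.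
      by apply: ge0_ler_powR; rewrite ?nnegrE ?(ltW t0) ?subr_ge0.
    by rewrite (@le_trans _ _ (t `^ (n.+1%:R - 1))) ?lerDr// ler_powR// lerD2r.
rewrite ge0_integralD//; last 4 first.
- by move=> t _; rewrite lee_fin gamma_fun_ge0.
- exact: measurable_funTS (mg _).
- by move=> t _; rewrite lee_fin gamma_fun_ge0.
- exact: measurable_funTS (mg _).
by rewrite egamma1 egamma_nat -EFinD ltry.
Qed.

Lemma GammaE (s : R) : 0 < s ->
  (\int[leb]_(t in `]0%R, +oo[) (gamma_fun s t)%:E = (Gamma s)%:E)%E.
Proof.
move=> s0; rewrite [RHS]fineK// ge0_fin_numE ?egamma_lty//.
by apply: integral_ge0 => t _; rewrite lee_fin gamma_fun_ge0.
Qed.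

Lemma GammaS (s : R) : 0 < s -> Gamma (s + 1) = s * Gamma s.
Proof.
move=> s0; apply: EFin_inj; rewrite EFinM -!GammaE//; last by rewrite addr_gt0.
exact: egammaS.
Qed.

(** On [1, 2] the integrand is bounded below by a positive constant. *)
Lemma Gamma_gt0 (s : R) : 0 < s -> 0 < Gamma s.
Proof.
move=> s0; rewrite -lte_fin -GammaE//.
pose m := Num.min 1 (2 `^ (s - 1)) * expR (- 2) : R.
have m0 : 0 < m by rewrite mulr_gt0 ?expR_gt0// lt_min ltr01 powR_gt0.
apply: (@lt_le_trans _ _ (\int[leb]_(t in `[1%R, 2%R]) m%:E)%E).
  rewrite integral_cst//= lebesgue_measure_itv/= lte_fin.
  by rewrite (_ : 1 < 2 :> R) ?ltr1n// -EFinB -EFinM lte_fin mulr_gt0.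
apply: (@le_trans _ _ (\int[leb]_(t in `[1%R, 2%R]) (gamma_fun s t)%:E)%E).
  apply: ge0_le_integral => //.
  - by move=> *; rewrite lee_fin ltW.
  - by apply/measurable_EFinP/measurable_funTS; exact: measurable_gamma_fun.
  move=> t; rewrite /= in_itv/= => /andP[t1 t2]; rewrite lee_fin /m /gamma_fun.
  apply: ler_pM; rewrite ?expR_ge0 ?ler_expR ?lerN2//.
  have [s1|s1] := leP 1 s.
    by rewrite ge_min -[X in X <= _](powRr0 t) ler_powR ?subr_ge0.
  rewrite ge_min; apply/orP; right.
  rewrite -[leRHS]invrK -[leLHS]invrK lef_pV2 ?posrE ?invr_gt0 ?powR_gt0 ?(lt_le_trans _ t1)//.
  rewrite -!powRN opprB; apply: ge0_ler_powR; rewrite ?nnegrE ?subr_ge0 ?(ltW s1)//.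
  exact: le_trans t1.
apply: ge0_subset_integral => //.
- by apply/measurable_EFinP/measurable_funTS; exact: measurable_gamma_fun.
- by move=> t _; rewrite lee_fin gamma_fun_ge0.
- by move=> t /=; rewrite !in_itv/= andbT => /andP[t1 _]; exact: lt_le_trans t1.
Qed.

End gamma.

(** * Integration over tuples *)

Section tuple_integral.
Context {R : realType}.
Local Notation T := (measurableTypeR R).
Local Notation leb := (@lebesgue_measure R).

Lemma integral_lebesgue_tuple0 (F : 0.-tuple T -> \bar R) :
  measurable_fun setT F -> (\int[@lebesgue_tuple R 0]_y F y = F [tuple])%E.
Proof. by move=> mF; rewrite /= integral_dirac// diracT mul1e. Qed.

Lemma measurable_comp_consT d (F : d.+1.-tuple T -> \bar R) :
  measurable_fun setT F -> measurable_fun setT (F \o @consT R d).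
Proof. by move=> mF; apply: measurableT_comp => //; exact: measurable_consT. Qed.

Lemma measurable_consT2 d (t : T) : measurable_fun setT (fun y : d.-tuple T => consT (t, y)).
Proof. by apply: measurable_cons; [exact: measurable_cst|exact: measurable_id]. Qed.

(** The recursive definition of the measure together with Tonelli's theorem; all
statements about tuples follow from it by induction on the dimension. *)
Lemma integral_lebesgue_tupleS d (F : d.+1.-tuple T -> \bar R) :
  measurable_fun setT F -> (forall y, 0 <= F y)%E ->
  (\int[@lebesgue_tuple R d.+1]_y F y =
   \int[leb]_t \int[@lebesgue_tuple R d]_y F (consT (t, y)))%E.
Proof.
move=> mF F0.
have := @ge0_integral_pushforward _ _ _ _ _ _ (@measurable_consT R d)
  (leb \x @lebesgue_tuple R d)%E setT F measurableT mF (fun y _ => F0 y).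
rewrite preimage_setT => -[E]; rewrite [LHS]E.
by rewrite (fubini_tonelli1 _ (measurable_comp_consT d F mF) (fun p => F0 (consT p))).
Qed.

Lemma measurable_integral_consT d (F : d.+1.-tuple T -> \bar R) :
  measurable_fun setT F -> (forall y, 0 <= F y)%E ->
  measurable_fun setT (fun t => \int[@lebesgue_tuple R d]_y F (consT (t, y)))%E.
Proof.
move=> mF F0.
exact: (measurable_fun_fubini_tonelli_F (m2 := @lebesgue_tuple R d) (F \o @consT R d)
  (measurable_comp_consT d F mF) (fun p => F0 (consT p))).
Qed.

(** The maps y |-> c - y generate translations and the central symmetry, which are
the only changes of variables in R^d that the proof needs. *)
Definition sub_tuple d (c : 'I_d -> R) (y : d.-tuple T) : d.-tuple T :=
  [tuple c i - tnth y i | i < d].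

Lemma measurable_sub_tuple d (c : 'I_d -> R) : measurable_fun setT (sub_tuple d c).
Proof.
apply/measurable_fun_tnthP => i.
rewrite (_ : _ \o _ = fun y => c i - tnth y i); last first.
  by apply/funext => y /=; rewrite tnth_mktuple.
by apply: measurable_funB => //; exact: measurable_tnth.
Qed.

Lemma sub_tuple_consT d (c : 'I_d.+1 -> R) (t : T) (y : d.-tuple T) :
  sub_tuple d.+1 c (consT (t, y)) =
  consT (c ord0 - t, sub_tuple d (fun i => c (lift ord0 i)) y).
Proof.
apply: eq_from_tnth => i; rewrite tnth_mktuple.
case: (unliftP ord0 i) => [j ->|->]; last by [].
by rewrite !tnthS tnth_mktuple.
Qed.

Lemma ge0_integral_sub_tuple d (c : 'I_d -> R) (F : d.-tuple T -> \bar R) :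
  measurable_fun setT F -> (forall y, 0 <= F y)%E ->
  (\int[@lebesgue_tuple R d]_y F (sub_tuple d c y) = \int[@lebesgue_tuple R d]_y F y)%E.
Proof.
elim: d c F => [|d IHd] c F mF F0.
  by apply: eq_integral => y _; rewrite [sub_tuple _ _ _]tuple0 [y]tuple0.
have mFs : measurable_fun setT (fun y => F (sub_tuple d.+1 c y)).
  by apply: (measurableT_comp mF); exact: measurable_sub_tuple.
rewrite (integral_lebesgue_tupleS d _ mFs (fun y => F0 _)).
rewrite (integral_lebesgue_tupleS d F mF F0).
pose G t := (\int[@lebesgue_tuple R d]_y F (consT (t, y)))%E.
transitivity (\int[leb]_t G (- 1 * t + c ord0)%R)%E.
  apply: eq_integral => t _; rewrite mulN1r addrC /G.
  under eq_integral do rewrite sub_tuple_consT.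
  apply: (IHd _ (fun y => F (consT (c ord0 - t, y)))) => //.
  by apply: (measurableT_comp mF); exact: measurable_consT2.
rewrite -[RHS](@ge0_integral_affine R (- 1) (c ord0) G) ?oppr_eq0 ?oner_eq0//.
- by rewrite normrN1 mul1e.
- exact: measurable_integral_consT.
- by move=> t; exact: integral_ge0.
Qed.

Definition dot_tuple d (a : 'I_d -> R) (y : d.-tuple T) : R := \sum_i a i * tnth y i.
Definition sqnorm_tuple d (y : d.-tuple T) : R := \sum_i tnth y i ^+ 2.

Lemma measurable_dot_tuple d a : measurable_fun setT (dot_tuple d a).
Proof.
apply: measurable_sum => i; apply: measurable_funM => //.
exact: measurable_tnth.
Qed.

Lemma measurable_sqnorm_tuple d : measurable_fun setT (sqnorm_tuple d).
Proof.
apply: measurable_sum => i; apply: measurable_funX; exact: measurable_tnth.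
Qed.

Lemma dot_tuple_consT d a (t : T) (y : d.-tuple T) :
  dot_tuple d.+1 a (consT (t, y)) = a ord0 * t + dot_tuple d (fun i => a (lift ord0 i)) y.
Proof.
by rewrite /dot_tuple big_ord_recl; congr (_ + _); apply: eq_bigr => i _; rewrite tnthS.
Qed.

Lemma sqnorm_tuple_ge0 d y : 0 <= sqnorm_tuple d y.
Proof. by apply: sumr_ge0 => i _; exact: sqr_ge0. Qed.

(** With c = 0, [sub_tuple] is the central symmetry. *)
Lemma dot_sub_tuple0 d a (y : d.-tuple T) :
  dot_tuple d a (sub_tuple d (fun=> 0) y) = - dot_tuple d a y.
Proof.
rewrite /dot_tuple -sumrN; apply: eq_bigr => i _.
by rewrite tnth_mktuple sub0r mulrN.
Qed.

Lemma sqnorm_sub_tuple0 d (y : d.-tuple T) :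
  sqnorm_tuple d (sub_tuple d (fun=> 0) y) = sqnorm_tuple d y.
Proof. by apply: eq_bigr => i _; rewrite tnth_mktuple sub0r sqrrN. Qed.

End tuple_integral.

(** * Gaussian weights *)

Section gaussian.
Context {R : realType}.
Local Notation T := (measurableTypeR R).
Local Notation leb := (@lebesgue_measure R).

(** The density of the centered normal law of variance 1 / (2 tau): the exponent is
kept linear in tau for the integration over tau. *)
Definition gauss_density (tau t : R) : R :=
  Num.sqrt (tau / pi) * expR (- (tau * t ^+ 2)).

Lemma gauss_density_ge0 tau t : 0 <= gauss_density tau t.
Proof. by rewrite mulr_ge0 ?sqrtr_ge0 ?expR_ge0. Qed.

Lemma continuous_gauss_density tau : continuous (gauss_density tau).
Proof.
move=> t; apply: cvgMl_tmp.
apply: (@continuous_comp _ _ _ (fun x : R => - (tau * x ^+ 2)) expR).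
  by apply: cvgN; apply: cvgMl_tmp; exact: exprn_continuous.
exact: continuous_expR.
Qed.

Lemma measurable_gauss_density tau : measurable_fun setT (gauss_density tau).
Proof. by apply: continuous_measurable_fun; exact: continuous_gauss_density. Qed.

Lemma integral_gauss_density tau : 0 < tau ->
  (\int[leb]_t (gauss_density tau t)%:E = 1)%E.
Proof.
move=> tau0; have st : Num.sqrt tau != 0 by rewrite gt_eqF// sqrtr_gt0.
have sp : Num.sqrt (pi : R) != 0 by rewrite gt_eqF// sqrtr_gt0 pi_gt0.
have m : measurable_fun setT (fun t : R => (gauss_fun t)%:E).
  by apply/measurable_EFinP; exact: measurable_gauss_fun.
have g0 (t : R) : (0 <= (gauss_fun t)%:E)%E by rewrite lee_fin gauss_fun_ge0.
have := ge0_integral_affine (Num.sqrt tau) 0 _ st m g0.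
rewrite integralT_gauss ger0_norm ?sqrtr_ge0// => E.
have mE : measurable_fun setT (fun t : R => expR (- (tau * t ^+ 2))).
  apply: (@measurableT_comp _ _ _ _ _ _ expR) => //.
  by apply: measurable_funN; apply: measurable_funM => //; exact: exprn_measurable.
rewrite /gauss_density ge0_integralZl_real ?sqrtr_ge0//.
have {}E : (\int[leb]_t (expR (- (tau * t ^+ 2)))%:E =
    ((Num.sqrt tau)^-1 * Num.sqrt pi)%:E)%E.
  rewrite EFinM -E muleA -EFinM mulVf// mul1e; apply: eq_integral => t _.
  by rewrite addr0 /gauss_fun exprMn sqr_sqrtr// ltW.
rewrite E -EFinM sqrtrM ?(ltW tau0)// sqrtrV ?pi_ge0//.
by congr EFin; field; rewrite st sp.
Qed.

Lemma integral_norm_gauss_density tau : 0 < tau ->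
  (\int[leb]_t (`|t| * gauss_density tau t)%:E = (Num.sqrt (tau * pi))^-1%:E)%E.
Proof.
move=> tau0.
rewrite ge0_symfun_integralT; first last.
- by move=> t /=; rewrite normrN /gauss_density sqrrN.
- move=> t; apply: cvgM; first exact: norm_continuous.
  exact: continuous_gauss_density.
- by move=> t; rewrite mulr_ge0// gauss_density_ge0.
pose C := Num.sqrt (tau / pi) : R.
pose F (t : R) := - (C / (2 * tau)) * expR (- (tau * t ^+ 2)).
rewrite (_ : [set x | 0 <= x] = `[0, +oo[%classic); last first.
  by apply/seteqP; split => x /=; rewrite in_itv/= andbT.
have tau20 : 2 * tau != 0 by rewrite gt_eqF// mulr_gt0.
have -> : (\int[leb]_(t in `[0%R, +oo[) (`|t| * gauss_density tau t)%:E =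
    \int[leb]_(t in `[0%R, +oo[) (t * gauss_density tau t)%:E)%E.
  apply: eq_integral => t; rewrite inE/= in_itv/= andbT => t0.
  by rewrite ger0_norm.
have -> : (\int[leb]_(t in `[0%R, +oo[) (t * gauss_density tau t)%:E =
    (- (C / (2 * tau)) * 0 - F 0%R)%:E)%E.
  apply: ge0_integral_antiderivative.
  - move=> t _; apply: is_derive_eq.
    rewrite /GRing.scale/= /gauss_density -/C; field.
    by move: tau20; rewrite mulf_eq0 negb_or => /andP[_ ->].
  - move=> t _; apply: cvgM; first exact: cvg_id.
    exact: continuous_gauss_density.
  - by move=> t t0; rewrite mulr_ge0// gauss_density_ge0.
  - apply: cvgMr.
    have t2 : (tau * t ^+ 2) @[t --> +oo] --> +oo.
      apply: gt0_cvgMry => //; exact: cvgr_expr2.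
    apply: (@cvg_comp _ _ _ (fun t => tau * t ^+ 2) (fun x => expR (- x)) _ (pinfty_nbhs R)).
      exact: t2.
    exact: cvgr_expR.
rewrite /F mulr0 sub0r expr0n/= mulr0 oppr0 expR0 mulr1 opprK -EFinM; congr EFin.
rewrite /C !sqrtrM ?(ltW tau0)// sqrtrV ?pi_ge0//.
have st : Num.sqrt tau != 0 by rewrite gt_eqF// sqrtr_gt0.
have sp : Num.sqrt (pi : R) != 0 by rewrite gt_eqF// sqrtr_gt0 pi_gt0.
rewrite -{2}(sqr_sqrtr (ltW tau0)).
by field; rewrite st sp.
Qed.

Lemma integral_gauss_abs tau b (h : R -> R) : 0 < tau ->
  measurable_fun setT h -> (forall t, 0 <= h t) ->
  (\int[leb]_v (h (b * v) * gauss_density tau v)%:E =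
   \int[leb]_v (h (`|b| * v) * gauss_density tau v)%:E)%E.
Proof.
move=> tau0 mh h0; have [b0|b0] := ger0P b; first by [].
pose F v := (h (- b * v) * gauss_density tau v)%:E.
have N1 : (- 1 : R) != 0 by rewrite oppr_eq0 oner_eq0.
rewrite -[RHS](ge0_integral_affine (- 1) 0 F N1).
- rewrite normrN1 mul1e; apply: eq_integral => v _.
  by rewrite /F addr0 mulN1r mulrNN /gauss_density sqrrN.
- apply/measurable_EFinP; apply: measurable_funM; last exact: measurable_gauss_density.
  by apply: (measurableT_comp mh); exact: measurable_funM.
- by move=> v; rewrite lee_fin mulr_ge0// gauss_density_ge0.
Qed.

(** The quadratic form (u - b y)^2 / a^2 + y^2 is u^2 / rho^2 plus a square that is
affine in y: completing the square plays the role of the rotation of the plane that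
carries (a, b) to (rho, 0). *)
Lemma gauss_density_rotate tau a b u y : 0 < tau -> a != 0 ->
  let rho := Num.sqrt (a ^+ 2 + b ^+ 2) in
  gauss_density tau ((u - b * y) / a) * gauss_density tau y =
  gauss_density tau (u / rho) * gauss_density tau (rho / a * y + - (u * b / (a * rho))).
Proof.
move=> tau0 a0 rho.
have rho2 : rho ^+ 2 = a ^+ 2 + b ^+ 2 by rewrite sqr_sqrtr// addr_ge0 ?sqr_ge0.
have rho0 : rho != 0.
  by rewrite sqrtr_eq0 -ltNge ltr_wpDr ?sqr_ge0// exprn_even_gt0.
rewrite /gauss_density mulrACA -expRD [RHS]mulrACA -expRD; congr (_ * expR _).
have -> : ((u - b * y) / a) ^+ 2 = (u ^+ 2 - 2 * u * b * y + b ^+ 2 * y ^+ 2) / a ^+ 2.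
  by field.
have -> : (rho / a * y + - (u * b / (a * rho))) ^+ 2 =
    (rho ^+ 2 * y ^+ 2 - 2 * u * b * y + u ^+ 2 * b ^+ 2 / rho ^+ 2) / a ^+ 2.
  by field; rewrite a0 rho0.
have -> : (u / rho) ^+ 2 = u ^+ 2 / rho ^+ 2 by field.
rewrite rho2; field; rewrite a0 -rho2 expf_eq0/= rho0//.
Qed.

(** If X and Y are independent centered normal variables with the same variance, then
a X + b Y has the law of sqrt (a^2 + b^2) X. The substitution u = a x + b y, which
needs a <> 0, replaces the variable x; after [gauss_density_rotate] the integral over
y is that of a Gaussian density. *)
Lemma integral_gauss2 tau a b (h : R -> R) : 0 < tau ->
  measurable_fun setT h -> (forall t, 0 <= h t) ->
  (\int[leb]_x \int[leb]_y
     (h (a * x + b * y) * (gauss_density tau x * gauss_density tau y))%:E =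
   \int[leb]_v (h (Num.sqrt (a ^+ 2 + b ^+ 2) * v) * gauss_density tau v)%:E)%E.
Proof.
move=> tau0 mh h0.
have mq := measurable_gauss_density tau.
have q0 := gauss_density_ge0 tau.
have [->|a0] := eqVneq a 0.
  rewrite expr0n/= add0r sqrtr_sqr -integral_gauss_abs//.
  under eq_integral => x _.
    under eq_integral => y _ do rewrite mul0r add0r mulrCA.
    rewrite ge0_integralZl_real//; last 2 first.
    - apply: measurable_funM => //.
      by apply: (measurableT_comp mh); exact: measurable_funM.
    - by move=> y; rewrite mulr_ge0.
    over.
  rewrite ge0_integralZr//.
  - by rewrite integral_gauss_density// mul1e.
  - by apply/measurable_EFinP.
  - by move=> x _; rewrite lee_fin.
  - by apply: integral_ge0 => y _; rewrite lee_fin mulr_ge0.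
set rho := Num.sqrt _.
have rho0 : 0 < rho.
  by rewrite sqrtr_gt0 ltr_wpDr ?sqr_ge0// exprn_even_gt0.
pose f (p : R * R) := (h (a * p.1 + b * p.2) * (gauss_density tau p.1 * gauss_density tau p.2))%:E.
have mf : measurable_fun setT f.
  apply/measurable_EFinP; apply: measurable_funM.
    by apply: (measurableT_comp mh); apply: measurable_funD; apply: measurable_funM.
  apply: measurable_funM.
    exact: (measurableT_comp mq measurable_fst).
  exact: (measurableT_comp mq measurable_snd).
have f0 p : (0 <= f p)%E by rewrite lee_fin mulr_ge0// mulr_ge0.
pose g (p : R * R) := (`|a|^-1 * (h p.1 *
  (gauss_density tau ((p.1 - b * p.2) / a) * gauss_density tau p.2)))%:E.
have mg : measurable_fun setT g.
  apply/measurable_EFinP; apply: measurable_funM => //; apply: measurable_funM.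
    exact: (measurableT_comp mh measurable_fst).
  apply: measurable_funM; last exact: (measurableT_comp mq measurable_snd).
  apply: (measurableT_comp mq).
  apply: measurable_funM => //; apply: measurable_funB; first exact: measurable_fst.
  by apply: measurable_funM => //; exact: measurable_snd.
have g0 p : (0 <= g p)%E by rewrite lee_fin !mulr_ge0// invr_ge0.
transitivity (\int[leb]_y \int[leb]_x f (x, y))%E.
  exact: (@fubini_tonelli _ _ _ _ _ leb leb f mf f0).
transitivity (\int[leb]_y \int[leb]_u g (u, y))%E.
  apply: eq_integral => y _.
  rewrite -(ge0_integral_affine a (b * y) (fun u => g (u, y)) a0); last by move=> x; exact: g0.
    rewrite -ge0_integralZl_EFin//; last first.
      apply: (measurableT_comp mg); apply: measurable_fun_pair => //.
      by apply: measurable_funD => //; exact: measurable_funM.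
    apply: eq_integral => x _; rewrite /f /g/= -EFinM; congr EFin.
    rewrite mulVKf ?normr_eq0// addrK.
    by rewrite [X in gauss_density tau (X / a)]mulrC mulfK.
  by apply: (measurableT_comp mg); exact: measurable_fun_pair.
transitivity (\int[leb]_u \int[leb]_y g (u, y))%E.
  symmetry; exact: (@fubini_tonelli _ _ _ _ _ leb leb g mg g0).
pose H u := (rho^-1 * (h u * gauss_density tau (u / rho)))%:E.
transitivity (\int[leb]_u H u)%E.
  apply: eq_integral => u _; rewrite /g/=.
  under eq_integral => y _.
    rewrite gauss_density_rotate// -/rho mulrA mulrA.
    over.
  have ra : rho / a != 0 by rewrite mulf_neq0 ?invr_eq0// gt_eqF.
  rewrite ge0_integralZl_real//; last 2 first.
  - by apply: (measurableT_comp mq); apply: measurable_funD.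
  - by rewrite !mulr_ge0// invr_ge0.
  have := ge0_integral_affine (rho / a) (- (u * b / (a * rho)))
    (fun y => (gauss_density tau y)%:E) ra.
  rewrite integral_gauss_density// => E.
  have {}E : (\int[leb]_y (gauss_density tau (rho / a * y + - (u * b / (a * rho))))%:E =
      (`|a| / rho)%:E)%E.
    rewrite -[LHS]mul1e -(@mulVf _ `|rho / a|) ?normr_eq0// EFinM -muleA E.
    - by rewrite mule1 normrM normfV invfM invrK (gtr0_norm rho0) mulrC.
    - exact/measurable_EFinP.
    - by move=> y; rewrite lee_fin.
  rewrite E -EFinM /H; congr EFin; field.
  by rewrite normr_eq0 a0 gt_eqF.
rewrite -(ge0_integral_affine rho 0 H) ?gt_eqF//.
- rewrite gtr0_norm// -ge0_integralZl_EFin ?(ltW rho0)//.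
  + apply: eq_integral => v _; rewrite /H addr0 -EFinM; congr EFin.
    rewrite [rho * v]mulrC mulfK ?gt_eqF//; field; by rewrite gt_eqF.
  + by move=> v _; rewrite lee_fin !mulr_ge0// invr_ge0 ltW.
  + apply/measurable_EFinP; apply: measurable_funM => //; apply: measurable_funM.
      by apply: (measurableT_comp mh); apply: measurable_funD.
    by apply: (measurableT_comp mq); apply: measurable_funM => //; apply: measurable_funD.
- apply/measurable_EFinP; apply: measurable_funM => //; apply: measurable_funM => //.
  by apply: (measurableT_comp mq); exact: measurable_funM.
- by move=> v; rewrite lee_fin !mulr_ge0// invr_ge0 ltW.
Qed.

Definition gauss_density_tuple tau d (y : d.-tuple T) : R :=
  \prod_i gauss_density tau (tnth y i).

Lemma measurable_gauss_density_tuple tau d :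
  measurable_fun setT (gauss_density_tuple tau d).
Proof.
apply: measurable_prod => i _.
exact: (measurableT_comp (measurable_gauss_density tau) (measurable_tnth i)).
Qed.

Lemma gauss_density_tuple_ge0 tau d y : 0 <= gauss_density_tuple tau d y.
Proof. by apply: prodr_ge0 => i _; exact: gauss_density_ge0. Qed.

Lemma gauss_density_tupleE tau d y :
  gauss_density_tuple tau d y = Num.sqrt (tau / pi) ^+ d * expR (- (tau * sqnorm_tuple d y)).
Proof.
elim: d y => [|d IHd] y.
  by rewrite /gauss_density_tuple /sqnorm_tuple !big_ord0 mulr0 oppr0 expR0 mulr1.
rewrite /gauss_density_tuple /sqnorm_tuple !big_ord_recl mulrDr opprD expRD exprS.
have := IHd [tuple tnth y (lift ord0 i) | i < d].
rewrite /gauss_density_tuple /sqnorm_tuple.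
under eq_bigr do rewrite tnth_mktuple.
under [in X in _ = X -> _]eq_bigr do rewrite tnth_mktuple.
by move=> ->; rewrite /gauss_density mulrACA.
Qed.

(** The law of a linear form under the product Gaussian weight depends only on the
length of its coefficient vector. In the induction step the hypothesis is applied to
h shifted by the contribution of the first coordinate, which leaves an integral over
two variables. *)
Lemma integral_gauss_direction tau d (a : 'I_d -> R) (h : R -> R) : 0 < tau ->
  measurable_fun setT h -> (forall t, 0 <= h t) ->
  (\int[@lebesgue_tuple R d]_y (h (dot_tuple d a y) * gauss_density_tuple tau d y)%:E =
   \int[leb]_v (h (Num.sqrt (\sum_i a i ^+ 2) * v) * gauss_density tau v)%:E)%E.
Proof.
move=> tau0; have mq := measurable_gauss_density tau.
have q0 := gauss_density_ge0 tau.
elim: d a h => [|d IHd] a h mh h0.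
  rewrite integral_lebesgue_tuple0; last first.
    apply/measurable_EFinP; apply: measurable_funM; last exact: measurable_gauss_density_tuple.
    exact: (measurableT_comp mh (measurable_dot_tuple 0 a)).
  rewrite /dot_tuple /gauss_density_tuple !big_ord0 sqrtr0 mulr1.
  under eq_integral do rewrite mul0r.
  by rewrite ge0_integralZl_real// integral_gauss_density// mule1.
pose a' i := a (lift ord0 i); pose rho := Num.sqrt (\sum_i a' i ^+ 2).
rewrite integral_lebesgue_tupleS; last 2 first.
- apply/measurable_EFinP; apply: measurable_funM; last exact: measurable_gauss_density_tuple.
  exact: (measurableT_comp mh (measurable_dot_tuple _ a)).
- by move=> y; rewrite lee_fin mulr_ge0// gauss_density_tuple_ge0.
have -> : \sum_i a i ^+ 2 = a ord0 ^+ 2 + rho ^+ 2.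
  by rewrite big_ord_recl sqr_sqrtr// sumr_ge0// => i _; exact: sqr_ge0.
rewrite -integral_gauss2//; apply: eq_integral => t _.
have mht : measurable_fun setT (fun s => h (a ord0 * t + s)).
  by apply: (measurableT_comp mh); exact: measurable_funD.
transitivity ((gauss_density tau t)%:E * \int[@lebesgue_tuple R d]_y
    (h (a ord0 * t + dot_tuple d a' y) * gauss_density_tuple tau d y)%:E)%E.
  rewrite -ge0_integralZl_real//; last 2 first.
  - apply: measurable_funM; last exact: measurable_gauss_density_tuple.
    exact: (measurableT_comp mht (measurable_dot_tuple _ a')).
  - by move=> y; rewrite mulr_ge0// gauss_density_tuple_ge0.
  apply: eq_integral => y _; congr EFin; rewrite dot_tuple_consT mulrCA; congr (_ * _).
  rewrite /gauss_density_tuple big_ord_recl; congr (_ * _).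
  by apply: eq_bigr => i _; rewrite tnthS.
rewrite (IHd a' (fun s => h (a ord0 * t + s)) mht (fun s => h0 _)) -/rho.
rewrite -ge0_integralZl_real//; last 2 first.
- apply: measurable_funM => //; apply: (measurableT_comp mht); exact: measurable_funM.
- by move=> v; rewrite mulr_ge0.
by apply: eq_integral => v _; rewrite mulrCA.
Qed.

End gaussian.

(** * Radial integrals *)

Section radial.
Context {R : realType}.
Local Notation T := (measurableTypeR R).
Local Notation leb := (@lebesgue_measure R).

Lemma sqrt_exprnE (x : R) d : 0 <= x -> Num.sqrt x ^+ d = x `^ (d%:R / 2).
Proof.
by move=> x0; rewrite -powR12_sqrt// -powR_mulrn ?powR_ge0// -powRrM mulrC.
Qed.

Lemma powRV (x p : R) : 0 < x -> x^-1 `^ p = (x `^ p)^-1.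
Proof. by move=> x0; rewrite -powR_inv1 ?ltW// -powRrM mulN1r powRN. Qed.

Lemma EFin_mull_eq (x y : R) (I : \bar R) : 0 < x -> (x%:E * I = y%:E)%E -> I = (y / x)%:E.
Proof.
by move=> x0 E; rewrite mulrC EFinM -E muleA -EFinM mulVf ?mul1e// gt_eqF.
Qed.

Lemma measurable_radial_powR d (r s : R) :
  measurable_fun setT (fun y : d.-tuple T => (r + sqnorm_tuple d y) `^ s).
Proof.
apply: (measurableT_comp (measurable_powR s)).
by apply: measurable_funD => //; exact: measurable_sqnorm_tuple.
Qed.

(** Subordination, Tonelli, and the Gaussian law of the linear form, for a test
function h whose Gaussian mean scales like a power of tau. Only h = 1 (p = 0) and
h = |.| (p = 1/2) occur below. *)
Lemma integral_radial_direction d (a : 'I_d -> R) (h : R -> R) (s r p K : R) :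
  measurable_fun setT h -> (forall t, 0 <= h t) ->
  0 < s -> 0 < r -> 0 <= K -> 0 < s - d%:R / 2 - p ->
  (forall tau, 0 < tau ->
    (\int[leb]_v (h (Num.sqrt (\sum_i a i ^+ 2) * v) * gauss_density tau v)%:E =
     (K * tau `^ (- p))%:E)%E) ->
  ((Gamma s)%:E * \int[@lebesgue_tuple R d]_y
      (h (dot_tuple d a y) * (r + sqnorm_tuple d y) `^ (- s))%:E =
   (K * pi `^ (d%:R / 2) * r `^ (- (s - d%:R / 2 - p)) * Gamma (s - d%:R / 2 - p))%:E)%E.
Proof.
move=> mh h0 s0 r0 K0 sp0 hK.
have ry0 (y : d.-tuple T) : 0 < r + sqnorm_tuple d y.
  by rewrite ltr_wpDr ?sqnorm_tuple_ge0.
have mhd := measurableT_comp mh (measurable_dot_tuple d a).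
pose f (q : R * d.-tuple T) :=
  (h (dot_tuple d a q.2) * (q.1 `^ (s - 1) * expR (- ((r + sqnorm_tuple d q.2) * q.1))))%:E.
have mf : measurable_fun setT f.
  apply/measurable_EFinP; apply: measurable_funM.
    exact: (measurableT_comp mhd measurable_snd).
  apply: measurable_funM; first exact: (measurableT_comp (measurable_powR (s - 1)) measurable_fst).
  apply: (@measurableT_comp _ _ _ _ _ _ expR) => //.
  apply: measurable_funN; apply: measurable_funM; last exact: measurable_fst.
  apply: measurable_funD => //.
  exact: (measurableT_comp (measurable_sqnorm_tuple d) measurable_snd).
have f0 q : (0 <= f q)%E by rewrite lee_fin !mulr_ge0// ?powR_ge0 ?expR_ge0.
have mrad := measurable_radial_powR d r (- s).
rewrite -ge0_integralZl_real ?(ltW (Gamma_gt0 _ s0))//; last 2 first.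
- exact: measurable_funM.
- by move=> y; rewrite mulr_ge0// powR_ge0.
transitivity (\int[@lebesgue_tuple R d]_y \int[leb]_(t in `]0%R, +oo[) f (t, y))%E.
  apply: eq_integral => y _; rewrite /f/= ge0_integralZl_real//; last 2 first.
  - apply: measurable_funM; first exact: measurable_powR.
    apply: (@measurableT_comp _ _ _ _ _ _ expR) => //.
    by apply: measurable_funN; exact: measurable_funM.
  - by move=> t; rewrite mulr_ge0 ?powR_ge0 ?expR_ge0.
  rewrite (integral_gamma_fun_scale _ _ (ry0 y)) GammaE// -!EFinM; congr EFin.
  by rewrite mulrC mulrA.
transitivity (\int[leb]_(t in `]0%R, +oo[) \int[@lebesgue_tuple R d]_y f (t, y))%E.
  symmetry; exact: (@ge0_fubini_set R _ _ _ _ leb (@lebesgue_tuple R d)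
    `]0, +oo[ setT f (measurable_itv _) measurableT mf f0).
transitivity (\int[leb]_(t in `]0%R, +oo[) ((K * pi `^ (d%:R / 2)) *
   (t `^ ((s - d%:R / 2 - p) - 1) * expR (- (r * t))))%:E)%E; last first.
  rewrite ge0_integralZl_real ?mulr_ge0 ?powR_ge0//; last 2 first.
  - apply: measurable_funM; first exact: measurable_powR.
    apply: (@measurableT_comp _ _ _ _ _ _ expR) => //.
    by apply: measurable_funN; exact: measurable_funM.
  - by move=> t; rewrite mulr_ge0 ?powR_ge0 ?expR_ge0.
  by rewrite (integral_gamma_fun_scale _ _ r0) GammaE// -!EFinM !mulrA.
apply: eq_integral => t; rewrite inE/= in_itv/= andbT => t0.
have tpi0 : 0 <= t / pi by rewrite divr_ge0 ?pi_ge0 ?ltW.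
have td0 : t `^ (d%:R / 2) != 0 by rewrite gt_eqF// powR_gt0.
have pd0 : (pi : R) `^ (d%:R / 2) != 0 by rewrite gt_eqF// powR_gt0// pi_gt0.
pose C := t `^ (s - 1) * expR (- (r * t)) / Num.sqrt (t / pi) ^+ d.
transitivity (C%:E * \int[@lebesgue_tuple R d]_y
    (h (dot_tuple d a y) * gauss_density_tuple t d y)%:E)%E.
  rewrite -ge0_integralZl_real//; last 3 first.
  - by apply: measurable_funM => //; exact: measurable_gauss_density_tuple.
  - by move=> y; rewrite mulr_ge0// gauss_density_tuple_ge0.
  - by rewrite /C divr_ge0 ?mulr_ge0 ?powR_ge0 ?expR_ge0// exprn_ge0// sqrtr_ge0.
  apply: eq_integral => y _; rewrite /f /C gauss_density_tupleE/=; congr EFin.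
  rewrite mulrDl opprD expRD (mulrC t (sqnorm_tuple d y)).
  field; rewrite sqrt_exprnE// powRM ?(ltW t0) ?invr_ge0 ?pi_ge0//.
  by rewrite mulf_neq0// powRV ?pi_gt0// invr_eq0.
rewrite integral_gauss_direction// hK// -EFinM; congr EFin.
rewrite /C sqrt_exprnE// powRM ?(ltW t0) ?invr_ge0 ?pi_ge0// powRV ?pi_gt0//.
have -> : s - d%:R / 2 - p - 1 = (s - 1) - d%:R / 2 + (- p) by ring.
have tne : t != 0 by rewrite gt_eqF.
set u := s - 1.
rewrite (@powRD _ _ (u - d%:R / 2)) ?tne ?implybT// (@powRB _ _ u) ?tne ?implybT//.
by field; rewrite td0 pd0.
Qed.

Lemma integral_radial d (s r : R) : 0 < r -> 0 < s - d%:R / 2 ->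
  (\int[@lebesgue_tuple R d]_y ((r + sqnorm_tuple d y) `^ (- s))%:E =
   (pi `^ (d%:R / 2) * r `^ (- (s - d%:R / 2)) * (Gamma (s - d%:R / 2) / Gamma s))%:E)%E.
Proof.
move=> r0 sd0; have s0 : 0 < s.
  by apply: (lt_le_trans sd0); rewrite gerBl divr_ge0.
have := @integral_radial_direction d (fun=> 0) (fun=> 1) s r 0 1.
rewrite subr0 => /(_ (measurable_cst _) (fun=> ler01) s0 r0 ler01 sd0).
under [X in (_ * X)%E]eq_integral do rewrite mul1r.
have H tau : 0 < tau -> (\int[leb]_v (1 * gauss_density tau v)%:E = (1 * tau `^ (- 0))%:E)%E.
  move=> tau0; under eq_integral do rewrite mul1r.
  by rewrite integral_gauss_density// oppr0 powRr0 mul1r.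
by move=> /(_ H)/(EFin_mull_eq _ _ _ (Gamma_gt0 _ s0)) ->; rewrite mul1r mulrA.
Qed.

Lemma integral_radial_norm_dot d (a : 'I_d -> R) (s r : R) : 0 < r -> 0 < s - (d%:R + 1) / 2 ->
  (\int[@lebesgue_tuple R d]_y (`|dot_tuple d a y| * (r + sqnorm_tuple d y) `^ (- s))%:E =
   (Num.sqrt (\sum_i a i ^+ 2) * (pi `^ (d%:R / 2) / Num.sqrt pi) *
    r `^ (- (s - (d%:R + 1) / 2)) * (Gamma (s - (d%:R + 1) / 2) / Gamma s))%:E)%E.
Proof.
move=> r0 sd0; have s0 : 0 < s.
  by apply: (lt_le_trans sd0); rewrite gerBl divr_ge0// addr_ge0.
set N := Num.sqrt (\sum_i a i ^+ 2).
have N0 : 0 <= N by exact: sqrtr_ge0.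
have sE : s - (d%:R + 1) / 2 = s - d%:R / 2 - 2^-1 by field.
have mn : measurable_fun setT (fun t : R => `|t|) by exact: normr_measurable.
have K0 : 0 <= N / Num.sqrt (pi : R) by rewrite divr_ge0// sqrtr_ge0.
have := @integral_radial_direction d a (fun t => `|t|) s r 2^-1
  (N / Num.sqrt pi) mn (@normr_ge0 _ _).
rewrite -sE => /(_ s0 r0 K0 sd0).
have H tau : 0 < tau -> (\int[leb]_v (`|N * v| * gauss_density tau v)%:E =
    (N / Num.sqrt pi * tau `^ (- 2^-1))%:E)%E.
  move=> tau0.
  transitivity (N%:E * \int[leb]_v (`|v| * gauss_density tau v)%:E)%E.
    rewrite -ge0_integralZl_real//; last 2 first.
    - by apply: measurable_funM => //; exact: measurable_gauss_density.
    - by move=> v; rewrite mulr_ge0// gauss_density_ge0.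
    by apply: eq_integral => v _; rewrite normrM (ger0_norm N0) -mulrA.
  rewrite integral_norm_gauss_density// -EFinM; congr EFin.
  by rewrite sqrtrM ?(ltW tau0)// powRN powR12_sqrt ?(ltW tau0)// invfM -mulrA;
    congr (_ * _); exact: mulrC.
move=> /(_ H)/(EFin_mull_eq _ _ _ (Gamma_gt0 _ s0)) ->; congr EFin.
by rewrite !mulrA; congr (_ * _ * _ / _); rewrite mulrAC.
Qed.

End radial.

(** * Directional masses of the gradient kernel *)

Section directional.
Context {R : realType} (d : nat).
Local Notation T := (measurableTypeR R).
Local Notation mu := (@lebesgue_tuple R d).

Lemma integrable_sub_tuple (c : 'I_d -> R) (g : d.-tuple T -> R) :
  mu.-integrable setT (EFin \o g) ->
  mu.-integrable setT (EFin \o (fun y => g (sub_tuple d c y))).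
Proof.
move=> ig; have mg : measurable_fun setT g.
  by apply/measurable_EFinP; exact: measurable_int ig.
apply/integrableP; split.
  apply/measurable_EFinP; exact: (measurableT_comp mg (measurable_sub_tuple d c)).
rewrite /= (ge0_integral_sub_tuple d c (fun y => (`|g y|)%:E))//.
  by have /integrableP[] := ig.
by apply/measurable_EFinP; exact: measurableT_comp.
Qed.

Lemma Rintegral_sub_tuple (c : 'I_d -> R) (g : d.-tuple T -> R) :
  measurable_fun setT g -> (forall y, 0 <= g y) ->
  \int[mu]_y g (sub_tuple d c y) = \int[mu]_y g y.
Proof.
move=> mg g0; rewrite /Rintegral (ge0_integral_sub_tuple d c (fun y => (g y)%:E))//.
exact/measurable_EFinP.
Qed.

Lemma integrable_radial (s r : R) : 0 < r -> 0 < s - d%:R / 2 ->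
  mu.-integrable setT (EFin \o (fun y => (r + sqnorm_tuple d y) `^ (- s))).
Proof.
move=> r0 sd0; apply/integrableP; split.
  by apply/measurable_EFinP; exact: measurable_radial_powR.
under eq_integral do rewrite /= ger0_norm ?powR_ge0//.
by rewrite integral_radial// ltry.
Qed.

Lemma Rintegral_radial (s r : R) : 0 < r -> 0 < s - d%:R / 2 ->
  \int[mu]_y ((r + sqnorm_tuple d y) `^ (- s)) =
  pi `^ (d%:R / 2) * r `^ (- (s - d%:R / 2)) * (Gamma (s - d%:R / 2) / Gamma s).
Proof. by move=> r0 sd0; rewrite /Rintegral integral_radial. Qed.

Lemma integrable_radial_dot (a : 'I_d -> R) (s r : R) : 0 < r -> 0 < s - (d%:R + 1) / 2 ->
  mu.-integrable setT
    (EFin \o (fun y => dot_tuple d a y * (r + sqnorm_tuple d y) `^ (- s))).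
Proof.
move=> r0 sd0; apply/integrableP; split.
  apply/measurable_EFinP; apply: measurable_funM; first exact: measurable_dot_tuple.
  exact: measurable_radial_powR.
under eq_integral do rewrite /= normrM [X in (_ * X)%:E]ger0_norm ?powR_ge0//.
by rewrite integral_radial_norm_dot// ltry.
Qed.

(** The central symmetry exchanges the positive and the negative part. *)
Lemma Rintegral_odd (f : d.-tuple T -> R) : mu.-integrable setT (EFin \o f) ->
  (forall y, f (sub_tuple d (fun=> 0) y) = - f y) -> \int[mu]_y f y = 0.
Proof.
move=> fi fN; rewrite /Rintegral.
have -> : (\int[mu]_y (f y)%:E = 0)%E; last by [].
have mf := measurable_int _ fi.
rewrite integralE.
have -> : (\int[mu]_y (fun y => (f y)%:E)^\- y = \int[mu]_y (fun y => (f y)%:E)^\+ y)%E.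
  rewrite -(ge0_integral_sub_tuple d (fun=> 0) ((fun y => (f y)%:E)^\+)%E).
  - by apply: eq_integral => y _; rewrite funeposE funenegE fN EFinN.
  - exact: measurable_funepos.
  - by move=> y; exact: funepos_ge0.
rewrite subee//.
by have := integrable_pos_fin_num measurableT fi.
Qed.

Definition radial_weight (beta c : R) (y : d.-tuple T) : R :=
  (c ^+ 2 + sqnorm_tuple d y) `^ (- (beta / 2 + 1)).

(** The derivative of the kernel in the direction (z, zn), without the factor
beta c^(alpha beta - 1); the point y stands for the offset x' - y. *)
Definition gradient_kernel (alpha beta c zn : R) (z : 'I_d -> R) (y : d.-tuple T) : R :=
  (zn * (alpha * (c ^+ 2 + sqnorm_tuple d y) - c ^+ 2) - c * dot_tuple d z y)
  * radial_weight beta c y.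

Lemma radial_weight_ge0 beta c y : 0 <= radial_weight beta c y.
Proof. exact: powR_ge0. Qed.

Lemma mul_radial_weight beta c y : 0 < c ->
  (c ^+ 2 + sqnorm_tuple d y) * radial_weight beta c y =
  (c ^+ 2 + sqnorm_tuple d y) `^ (- (beta / 2)).
Proof.
move=> c0; have D0 : 0 < c ^+ 2 + sqnorm_tuple d y.
  by rewrite ltr_wpDr ?sqnorm_tuple_ge0// exprn_gt0.
rewrite -(gt0_mul_powRB1 _ (- (beta / 2)) D0) /radial_weight.
by congr (_ * _ `^ _); ring.
Qed.

Lemma normal_kernelE alpha beta c y : 0 < c ->
  (alpha * (c ^+ 2 + sqnorm_tuple d y) - c ^+ 2) * radial_weight beta c y =
  alpha * (c ^+ 2 + sqnorm_tuple d y) `^ (- (beta / 2)) -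
  c ^+ 2 * (c ^+ 2 + sqnorm_tuple d y) `^ (- (beta / 2 + 1)).
Proof. by move=> c0; rewrite mulrBl -mulrA mul_radial_weight. Qed.

(** The normal part of the kernel dominates its tangential part when the direction is
close to the normal. By Cauchy-Schwarz c |z| |y| <= L c |y| <= L (c^2 + |y|^2) with
L = (alpha - 1) w, and alpha (c^2 + |y|^2) - c^2 exceeds (alpha - 1) (c^2 + |y|^2) by
|y|^2. *)
Lemma norm_dot_tuple_le (z : 'I_d -> R) (alpha c w : R) (y : d.-tuple T) :
  0 < c -> 1 <= alpha -> 0 <= w -> Num.sqrt (\sum_i z i ^+ 2) <= (alpha - 1) * w ->
  c * `|dot_tuple d z y| <= w * (alpha * (c ^+ 2 + sqnorm_tuple d y) - c ^+ 2).
Proof.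
move=> c0 al1 w0 small; set S := \sum_i z i ^+ 2 in small.
have S0 : 0 <= S by apply: sumr_ge0 => i _; exact: sqr_ge0.
set Y := sqnorm_tuple d y; have Y0 : 0 <= Y by exact: sqnorm_tuple_ge0.
set L := (alpha - 1) * w in small.
have L0 : 0 <= L by rewrite mulr_ge0// subr_ge0.
have SL : S <= L ^+ 2 by rewrite -(sqr_sqrtr S0) ler_pXn2r ?nnegrE ?sqrtr_ge0.
apply: (@le_trans _ _ (L * (c ^+ 2 + Y))); last first.
  rewrite /L [(alpha - 1) * _]mulrC -mulrA ler_wpM2l//.
  by rewrite -subr_ge0 (_ : _ - _ = Y)//; ring.
have Sz i : z i ^+ 2 <= S.
  by rewrite /S (bigD1 i)//= lerDl sumr_ge0// => j _; exact: sqr_ge0.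
have [L00|Lneq0] := eqVneq L 0.
  rewrite L00 mul0r /dot_tuple big1 ?normr0 ?mulr0// => i _.
  have : z i ^+ 2 <= 0 by rewrite (le_trans (Sz i))// (le_trans SL)// L00 expr0n.
  by rewrite real_exprn_even_le0 ?num_real//= => /eqP ->; rewrite mul0r.
have Lgt0 : 0 < L by rewrite lt_neqAle eq_sym Lneq0.
(* Termwise 2 (L |y_i|) (c |z_i|) <= (L y_i)^2 + (c z_i)^2. *)
have bound : 2 * (L * (c * `|dot_tuple d z y|)) <= c ^+ 2 * S + L ^+ 2 * Y.
  rewrite /dot_tuple /S /Y /sqnorm_tuple !mulr_sumr -big_split/=.
  apply: (@le_trans _ _ (\sum_i 2 * (L * (c * (`|z i| * `|tnth y i|))))).
    rewrite -!mulr_sumr !ler_wpM2l// ?(ltW c0)// (le_trans (ler_norm_sum _ _ _))//.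
    by apply: ler_sum => i _; rewrite normrM.
  apply: ler_sum => i _; rewrite -(real_normK (num_real (z i))).
  rewrite -(real_normK (num_real (tnth y i))) -subr_ge0.
  rewrite (_ : _ - _ = (c * `|z i| - L * `|tnth y i|) ^+ 2) ?sqr_ge0//; ring.
have : 2 * (L * (c * `|dot_tuple d z y|)) <= 2 * (L * (L * (c ^+ 2 + Y))).
  apply: (le_trans bound); apply: (@le_trans _ _ (L ^+ 2 * (c ^+ 2 + Y))).
    by rewrite mulrDr lerD2r mulrC ler_wpM2r// sqr_ge0.
  rewrite [leRHS]mulr_natl mulr2n mulrA -expr2 lerDl.
  exact: (mulr_ge0 (sqr_ge0 L) (addr_ge0 (sqr_ge0 c) Y0)).
by rewrite ler_pM2l// ler_pM2l.
Qed.

Variables (alpha beta c : R).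
Hypotheses (al1 : 1 <= alpha) (bd : d%:R < beta) (c0 : 0 < c).

Let u := (beta - d%:R) / 2.
Let u0 : 0 < u. Proof. by rewrite divr_gt0// subr_gt0. Qed.
Let b0 : 0 < beta. Proof. exact: le_lt_trans bd. Qed.
Let bh0 : 0 < beta / 2. Proof. by rewrite divr_gt0. Qed.
Let c20 : 0 < c ^+ 2. Proof. exact: exprn_gt0. Qed.
Let uE : beta / 2 - d%:R / 2 = u. Proof. by rewrite /u; field. Qed.
Let u1E : beta / 2 + 1 - d%:R / 2 = u + 1. Proof. by rewrite /u; field. Qed.
Let uhE : beta / 2 + 1 - (d%:R + 1) / 2 = u + 2^-1. Proof. by rewrite /u; field. Qed.

(** The integral M of the kernel in the normal direction. *)
Definition kernel_mass : R :=
  pi `^ (d%:R / 2) * (c ^+ 2) `^ (- u) * (Gamma u / (beta * Gamma (beta / 2)))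
  * ((alpha - 1) * beta + d%:R).

(** The integral B of the absolute value of the tangential part of the kernel for a
unit tangential vector. *)
Definition dot_mass : R :=
  pi `^ (d%:R / 2) / Num.sqrt pi * (c ^+ 2) `^ (- u) *
  (2 * Gamma (u + 2^-1) / (beta * Gamma (beta / 2))).

Lemma integrable_normal_kernel : mu.-integrable setT (EFin \o (fun y =>
  (alpha * (c ^+ 2 + sqnorm_tuple d y) - c ^+ 2) * radial_weight beta c y)).
Proof.
have i1 := integrable_radial (beta / 2) (c ^+ 2) c20.
have i2 := integrable_radial (beta / 2 + 1) (c ^+ 2) c20.
rewrite uE in i1; rewrite u1E in i2.
have := integrableB measurableT (integrableZl measurableT alpha (i1 u0))
  (integrableZl measurableT (c ^+ 2) (i2 (addr_gt0 u0 ltr01))).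
apply: eq_integrable => // y _ /=.
by rewrite normal_kernelE// EFinB !EFinM.
Qed.

Lemma Rintegral_normal_kernel :
  \int[mu]_y ((alpha * (c ^+ 2 + sqnorm_tuple d y) - c ^+ 2) * radial_weight beta c y)
  = kernel_mass.
Proof.
have i1 := integrable_radial (beta / 2) (c ^+ 2) c20.
have i2 := integrable_radial (beta / 2 + 1) (c ^+ 2) c20.
rewrite uE in i1; rewrite u1E in i2.
have {}i1 := i1 u0; have {}i2 := i2 (addr_gt0 u0 ltr01).
transitivity (\int[mu]_y (alpha * (c ^+ 2 + sqnorm_tuple d y) `^ (- (beta / 2))
    - c ^+ 2 * (c ^+ 2 + sqnorm_tuple d y) `^ (- (beta / 2 + 1)))).
  by apply: eq_Rintegral => y _; exact: normal_kernelE.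
rewrite RintegralB//; last 2 first.
- exact: (integrableZl measurableT alpha i1).
- exact: (integrableZl measurableT (c ^+ 2) i2).
rewrite !RintegralZl// !Rintegral_radial ?uE ?u1E ?addr_gt0//.
rewrite (GammaS _ u0) (GammaS _ bh0) /kernel_mass.
have -> : (c ^+ 2) `^ (- (u + 1)) = (c ^+ 2) `^ (- u) / c ^+ 2.
  by rewrite opprD powRD ?(gt_eqF c20) ?implybT// powR_inv1 ?ltW.
have g0 : Gamma (beta / 2) != 0 by rewrite gt_eqF// Gamma_gt0// divr_gt0.
move: (pi `^ _) ((c ^+ 2) `^ _) (Gamma u) => P C G; rewrite /u.
by field; rewrite g0 !gt_eqF.
Qed.

Lemma Rintegral_norm_dot (z : 'I_d -> R) :
  \int[mu]_y (`|c * dot_tuple d z y| * radial_weight beta c y)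
  = Num.sqrt (\sum_i z i ^+ 2) * dot_mass.
Proof.
have -> : \int[mu]_y (`|c * dot_tuple d z y| * radial_weight beta c y) =
   \int[mu]_y (`|dot_tuple d (fun i => c * z i) y| * radial_weight beta c y).
  apply: eq_Rintegral => y _; congr (`|_| * _).
  by rewrite /dot_tuple mulr_sumr; apply: eq_bigr => i _; rewrite mulrA.
rewrite /Rintegral integral_radial_norm_dot ?uhE ?addr_gt0//=.
have -> : Num.sqrt (\sum_i (c * z i) ^+ 2) = c * Num.sqrt (\sum_i z i ^+ 2).
  under eq_bigr do rewrite exprMn.
  by rewrite -mulr_sumr sqrtrM ?ltW// sqrtr_sqr gtr0_norm.
rewrite (GammaS _ bh0) /dot_mass.
have -> : (c ^+ 2) `^ (- (u + 2^-1)) = (c ^+ 2) `^ (- u) / c.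
  rewrite opprD powRD ?(gt_eqF c20) ?implybT// [X in _ * X]powRN.
  by rewrite powR12_sqrt ?ltW// sqrtr_sqr gtr0_norm.
have g0 : Gamma (beta / 2) != 0 by rewrite gt_eqF// Gamma_gt0// divr_gt0.
have sp : Num.sqrt (pi : R) != 0 by rewrite gt_eqF// sqrtr_gt0 pi_gt0.
move: (Gamma (u + _)) (pi `^ _) ((c ^+ 2) `^ _) (Gamma (beta / 2)) g0 => G P C G' g0.
by field; rewrite g0 sp !gt_eqF.
Qed.

Lemma kernel_mass_ge0 : 0 <= kernel_mass.
Proof.
have g0 : 0 < Gamma (beta / 2) by rewrite Gamma_gt0// divr_gt0.
rewrite !mulr_ge0 ?powR_ge0 ?invr_ge0 ?mulr_ge0 ?(ltW g0) ?(ltW b0) ?(ltW (Gamma_gt0 _ u0))//.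
by rewrite addr_ge0// mulr_ge0 ?subr_ge0 ?(ltW b0).
Qed.

(** B / M <= tan (arctan (alpha - 1) / 2), cleared of denominators. *)
Hypothesis ratio : 2 * Gamma (u + 2^-1) <=
  (alpha - 1) / (1 + Num.sqrt (1 + (alpha - 1) ^+ 2)) *
  (Num.sqrt pi * (beta * (alpha - 1) + d%:R) * Gamma u).

Lemma dot_mass_le : dot_mass <=
  (alpha - 1) / (1 + Num.sqrt (1 + (alpha - 1) ^+ 2)) * kernel_mass.
Proof.
have g0 : 0 < Gamma (beta / 2) by rewrite Gamma_gt0// divr_gt0.
have sp : 0 < Num.sqrt (pi : R) by rewrite sqrtr_gt0 pi_gt0.
pose P : R := pi `^ (d%:R / 2) / Num.sqrt pi * (c ^+ 2) `^ (- u) / (beta * Gamma (beta / 2)).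
have P0 : 0 <= P.
  by rewrite !mulr_ge0 ?powR_ge0 ?invr_ge0 ?mulr_ge0 ?(ltW g0) ?(ltW b0) ?(ltW sp).
have := ler_wpM2l P0 ratio.
have -> : P * (2 * Gamma (u + 2^-1)) = dot_mass.
  rewrite /P /dot_mass.
  move: (Gamma (u + _)) (pi `^ _) ((c ^+ 2) `^ _) (Gamma (beta / 2)) g0 => G Q C G' g0.
  by field; rewrite !gt_eqF.
move/le_trans; apply; rewrite le_eqVlt; apply/orP; left; apply/eqP.
have E0 : 1 + Num.sqrt (1 + (alpha - 1) ^+ 2) != 0.
  by rewrite gt_eqF// ltr_wpDr// sqrtr_ge0.
rewrite /P /kernel_mass; move: (1 + _) E0 => E E0.
move: (Gamma u) (pi `^ _) ((c ^+ 2) `^ _) (Gamma (beta / 2)) g0 => G Q C G' g0.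
by field; rewrite E0 !gt_eqF.
Qed.

(** With s = N sin g, zn = N cos g and t <= tan g, the left-hand side is at most
N (cos g + sin g tan (g / 2)) = N, since t / (1 + E) = tan (arctan t / 2) for
E = sqrt (1 + t^2). *)
Lemma half_angle_le (t zn s E N : R) : 0 <= t -> 0 <= s -> 0 <= zn ->
  E ^+ 2 = 1 + t ^+ 2 -> 0 <= E -> N ^+ 2 = s ^+ 2 + zn ^+ 2 -> 0 <= N -> t * zn <= s ->
  zn + s * (t / (1 + E)) <= N.
Proof.
move=> t0 s0 zn0 E2 E0 N2 N0 tzs.
have E1 : 0 < 1 + E by rewrite ltr_wpDr.
have tN : t * N <= s * E.
  rewrite -(@ler_pXn2r _ 2)// ?nnegrE ?mulr_ge0//.
  rewrite !exprMn N2 E2 mulrDr mulrDr mulr1 addrC (mulrC (t ^+ 2) (s ^+ 2)) lerD2r.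
  by rewrite -exprMn ler_pXn2r ?nnegrE ?mulr_ge0.
have znN : zn <= N.
  by rewrite -(@ler_pXn2r _ 2)// ?nnegrE// N2 lerDr sqr_ge0.
rewrite mulrA -lerBrDl ler_pdivrMr//.
(* Multiply by N + zn and use N^2 - zn^2 = s^2. *)
have [/eqP|Nz0] := eqVneq (N + zn) 0.
  rewrite paddr_eq0// => /andP[/eqP N00 /eqP zn00].
  move: N2; rewrite N00 zn00 expr0n/= addr0 => /esym/eqP; rewrite expf_eq0/= => /eqP ->.
  by rewrite mul0r subrr mul0r.
have Nz : 0 < N + zn by rewrite lt_neqAle eq_sym Nz0 addr_ge0.
rewrite -(ler_pM2r Nz).
have -> : (N - zn) * (1 + E) * (N + zn) = s * (s * (1 + E)).
  rewrite mulrAC -subr_sqr N2; ring.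
rewrite -mulrA ler_wpM2l// mulrDr mulrDr mulr1 addrC lerD//.
Qed.

Lemma gradient_kernelE (z : 'I_d -> R) (zn : R) y :
  gradient_kernel alpha beta c zn z y =
  zn * ((alpha * (c ^+ 2 + sqnorm_tuple d y) - c ^+ 2) * radial_weight beta c y)
  - c * dot_tuple d z y * radial_weight beta c y.
Proof. by rewrite /gradient_kernel mulrBl !mulrA. Qed.

Lemma integrable_tangential_kernel (z : 'I_d -> R) : mu.-integrable setT
  (EFin \o (fun y => c * dot_tuple d z y * radial_weight beta c y)).
Proof.
have := integrable_radial_dot z (beta / 2 + 1) (c ^+ 2) c20.
have h0 : 0 < u + 2^-1 by rewrite addr_gt0.
rewrite uhE => /(_ h0)/(integrableZl measurableT c).
by apply: eq_integrable => // y _; rewrite /= -EFinM mulrA.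
Qed.

Lemma integrable_gradient_kernel (z : 'I_d -> R) (zn : R) :
  mu.-integrable setT (EFin \o gradient_kernel alpha beta c zn z).
Proof.
have := integrableB measurableT (integrableZl measurableT zn integrable_normal_kernel)
  (integrable_tangential_kernel z).
apply: eq_integrable => // y _ /=.
by rewrite gradient_kernelE EFinB EFinM.
Qed.

(** The normal direction is extremal: near it the kernel has a constant sign and its
odd part integrates to 0, away from it the triangle inequality loses less than the
margin granted by [half_angle_le]. *)
Lemma Rintegral_gradient_kernel_le (z : 'I_d -> R) (zn : R) :
  \int[mu]_y `|gradient_kernel alpha beta c zn z y| <=
  Num.sqrt (\sum_i z i ^+ 2 + zn ^+ 2) * kernel_mass.
Proof.
set p := fun y => (alpha * (c ^+ 2 + sqnorm_tuple d y) - c ^+ 2) * radial_weight beta c y.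
set q := fun y => c * dot_tuple d z y * radial_weight beta c y.
have ip : mu.-integrable setT (EFin \o p) by exact: integrable_normal_kernel.
have iq : mu.-integrable setT (EFin \o q) by exact: integrable_tangential_kernel.
have kE y : gradient_kernel alpha beta c zn z y = zn * p y - q y.
  exact: gradient_kernelE.
have p0 y : 0 <= p y.
  rewrite mulr_ge0 ?radial_weight_ge0// subr_ge0.
  rewrite (@le_trans _ _ (1 * (c ^+ 2 + sqnorm_tuple d y)))//.
    by rewrite mul1r lerDl sqnorm_tuple_ge0.
  by rewrite ler_wpM2r// addr_ge0 ?sqr_ge0 ?sqnorm_tuple_ge0.
have M0 := kernel_mass_ge0.
set S := \sum_i z i ^+ 2; have S0 : 0 <= S by apply: sumr_ge0 => i _; exact: sqr_ge0.
have t0 : 0 <= alpha - 1 by rewrite subr_ge0.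
have [small|big] := leP (Num.sqrt S) ((alpha - 1) * `|zn|).
- have qp y : `|q y| <= `|zn| * p y.
    rewrite /q /p normrM (ger0_norm (radial_weight_ge0 _ _ _)) mulrA.
    rewrite ler_wpM2r ?radial_weight_ge0// normrM gtr0_norm//.
    exact: norm_dot_tuple_le.
  pose e : R := if 0 <= zn then 1 else - 1.
  have -> : \int[mu]_y `|gradient_kernel alpha beta c zn z y| =
      \int[mu]_y (`|zn| * p y - e * q y).
    apply: eq_Rintegral => y _; rewrite kE; have := qp y; rewrite /e.
    case: (ger0P zn) => zn0.
      by rewrite ler_norml => /andP[_ qpy]; rewrite mul1r ger0_norm ?subr_ge0.
    rewrite ler_norml mulNr opprK => /andP[qpy _].
    by rewrite ler0_norm ?subr_le0// opprB mulN1r opprK addrC.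
  rewrite RintegralB//; last 2 first.
  + exact: (integrableZl measurableT `|zn| ip).
  + exact: (integrableZl measurableT e iq).
  rewrite !RintegralZl// Rintegral_normal_kernel Rintegral_odd//; last first.
    move=> y; rewrite /q dot_sub_tuple0 /radial_weight sqnorm_sub_tuple0.
    by rewrite mulrN mulNr.
  rewrite mulr0 subr0 ler_wpM2r// -sqrtr_sqr ler_sqrt ?addr_ge0 ?sqr_ge0//.
  by rewrite lerDr.
- apply: (@le_trans _ _ (\int[mu]_y (`|zn| * p y + `|q y|))).
    apply: le_Rintegral => //.
    + exact: integrable_norm (integrable_gradient_kernel z zn).
    + have := integrableD measurableT (integrableZl measurableT `|zn| ip)
        (integrable_norm iq).
      exact: eq_integrable.
    + move=> y _; rewrite kE (le_trans (ler_normB _ _))// normrM (ger0_norm (p0 y))//.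
  rewrite RintegralD//; last 2 first.
  + exact: (integrableZl measurableT `|zn| ip).
  + exact: integrable_norm.
  rewrite RintegralZl// Rintegral_normal_kernel.
  have -> : \int[mu]_y `|q y| = Num.sqrt S * dot_mass.
    rewrite -Rintegral_norm_dot; apply: eq_Rintegral => y _.
    by rewrite /q normrM [X in _ * X]ger0_norm// radial_weight_ge0.
  apply: (@le_trans _ _ ((`|zn| + Num.sqrt S *
     ((alpha - 1) / (1 + Num.sqrt (1 + (alpha - 1) ^+ 2)))) * kernel_mass)).
    by rewrite mulrDl lerD2l -mulrA ler_wpM2l ?sqrtr_ge0// dot_mass_le.
  rewrite ler_wpM2r//; apply: half_angle_le; rewrite ?sqrtr_ge0 ?(ltW big)//.
  + by rewrite sqr_sqrtr// addr_ge0// sqr_ge0.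
  + by rewrite !sqr_sqrtr ?addr_ge0 ?sqr_ge0// real_normK ?num_real.
Qed.

End directional.

(** * The kernel of the potential along a line *)

Section kernel.
Context {R : realType} (n : nat).
Local Notation d := (n.-1).
Local Notation T := (measurableTypeR R).
Local Notation mu := (@lebesgue_tuple R d).
Implicit Types (x v : 'rV[R]_(d + 1)) (y : d.-tuple T).

Definition tangential x : 'I_d -> R := fun i => x 0 (lshift 1 i).

(** The horizontal displacement x' - y. *)
Definition offset x y : d.-tuple T := sub_tuple d (tangential x) y.

Definition sqdist x y : R := normal_coord x ^+ 2 + sqnorm_tuple d (offset x y).

Lemma sum_coordE (F : R -> R) x :
  \sum_i F (x 0 i) = \sum_(i < d) F (tangential x i) + F (normal_coord x).
Proof. by rewrite big_split_ord/= big_ord1. Qed.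

Lemma enorm_boundary_pointE x y : enorm (boundary_point y - x) = Num.sqrt (sqdist x y).
Proof.
rewrite /enorm (sum_coordE (fun t => t ^+ 2)) addrC; congr (Num.sqrt (_ + _)).
  by rewrite /normal_coord mxE [X in _ + X]mxE /boundary_point row_mxEr mxE sub0r sqrrN.
apply: eq_bigr => i _.
rewrite /tangential mxE [X in _ + X]mxE /boundary_point row_mxEl mxE tnth_mktuple.
by rewrite -sqrrN opprB.
Qed.

Lemma sqdist_ge x y : normal_coord x ^+ 2 <= sqdist x y.
Proof. by rewrite lerDl sqnorm_tuple_ge0. Qed.

Lemma sqdist_gt0 x y : half_space x -> 0 < sqdist x y.
Proof. by move=> x0; apply: lt_le_trans (sqdist_ge x y); exact: exprn_gt0. Qed.

Lemma potential_kernelE alpha beta x y : half_space x ->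
  (normal_coord x `^ alpha / enorm (boundary_point y - x)) `^ beta =
  normal_coord x `^ (alpha * beta) * sqdist x y `^ (- (beta / 2)).
Proof.
move=> x0; have D0 := sqdist_gt0 x y x0.
rewrite enorm_boundary_pointE powRM ?powR_ge0 ?invr_ge0 ?sqrtr_ge0// -powRrM.
congr (_ * _); rewrite powRV ?sqrtr_gt0// -powR12_sqrt ?(ltW D0)// -powRrM powRN.
by congr (_ `^ _)^-1; rewrite mulrC.
Qed.

(** Along a line the squared distance is a quadratic polynomial in the step h; its
coefficients are the only place where the dimension enters. *)
Lemma sqdist_line x v y h : sqdist (h *: v + x) y =
  (\sum_i v 0 i ^+ 2) * h ^+ 2 +
  2 * (normal_coord v * normal_coord x + dot_tuple d (tangential v) (offset x y)) * h
  + sqdist x y.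
Proof.
rewrite (sum_coordE (fun t => t ^+ 2)) /sqdist /normal_coord !mxE /sqnorm_tuple /dot_tuple.
have -> : \sum_i tnth (offset (h *: v + x) y) i ^+ 2 =
  (\sum_i tangential v i ^+ 2) * h ^+ 2 +
  2 * h * (\sum_i tangential v i * tnth (offset x y) i) + \sum_i tnth (offset x y) i ^+ 2.
  rewrite mulr_suml mulr_sumr -!big_split/=; apply: eq_bigr => i _.
  by rewrite !tnth_mktuple /tangential !mxE; ring.
by ring.
Qed.

Lemma normal_coord_line x v h : normal_coord (h *: v + x) = h * normal_coord v + normal_coord x.
Proof. by rewrite /normal_coord !mxE. Qed.

Lemma is_derive_quadratic (A B C h : R) :
  is_derive h 1 (fun h => A * h ^+ 2 + B * h + C) (2 * A * h + B).
Proof.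
apply: is_derive_eq; rewrite /GRing.scale/=.
by ring.
Qed.

Lemma is_derive_kernel_line (p q c w A B D h : R) :
  0 < h * w + c -> 0 < A * h ^+ 2 + 2 * B * h + D ->
  is_derive h 1 (fun h => (h * w + c) `^ p * (A * h ^+ 2 + 2 * B * h + D) `^ q)
    (p * w * (h * w + c) `^ (p - 1) * (A * h ^+ 2 + 2 * B * h + D) `^ q
     + 2 * q * (A * h + B) * (h * w + c) `^ p * (A * h ^+ 2 + 2 * B * h + D) `^ (q - 1)).
Proof.
move=> c0 Q0.
have dl : is_derive h 1 (fun h : R => h * w + c) w.
  by apply: is_derive_eq; rewrite /GRing.scale/= mulr0 add0r addr0 mulr1.
have dq := is_derive_quadratic A (2 * B) D h.
have d1 : is_derive h 1 (fun h : R => (h * w + c) `^ p) (p * (h * w + c) `^ (p - 1) * w).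
  exact: (@is_derive1_comp _ (fun t => t `^ p) (fun h => h * w + c) h _ _
    (is_derive1_powR p c0) dl).
have d2 : is_derive h 1 (fun h : R => (A * h ^+ 2 + 2 * B * h + D) `^ q)
    (q * (A * h ^+ 2 + 2 * B * h + D) `^ (q - 1) * (2 * A * h + 2 * B)).
  exact: (@is_derive1_comp _ (fun t => t `^ q) (fun h => A * h ^+ 2 + 2 * B * h + D) h _ _
    (is_derive1_powR q Q0) dq).
by apply: is_derive_eq; rewrite /GRing.scale/=; ring.
Qed.

Lemma ler_npowR (a t p : R) : p <= 0 -> 0 < a -> a <= t -> t `^ p <= a `^ p.
Proof.
move=> p0 a0 at_; have t0 : 0 < t by exact: lt_le_trans at_.
have E z : z `^ p = (z `^ (- p))^-1 by rewrite powRN invrK.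
rewrite (E t) (E a) lef_pV2 ?posrE ?powR_gt0//.
by apply: ge0_ler_powR; rewrite ?nnegrE ?oppr_ge0 ?(ltW t0) ?(ltW a0).
Qed.

Lemma powR_le_ends (a b t p : R) : 0 < a -> a <= t -> t <= b -> t `^ p <= a `^ p + b `^ p.
Proof.
move=> a0 at_ tb; have t0 : 0 < t by exact: lt_le_trans at_.
have [p0|p0] := leP 0 p.
  rewrite (@le_trans _ _ (b `^ p)) ?lerDr ?powR_ge0//.
  by apply: ge0_ler_powR; rewrite ?nnegrE ?(ltW t0)// (ltW (lt_le_trans t0 tb)).
by rewrite (@le_trans _ _ (a `^ p)) ?lerDl ?powR_ge0// ler_npowR// ltW.
Qed.

(** Domination for differentiating under the integral sign, uniformly in the boundary
point: B and D depend on it, K and the range of h do not. Both estimates come from the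
polynomial Q(t) = A t^2 + 2 B t + D being nonnegative at well-chosen points: Q(2 h) >= 0
gives Q(h) >= D / 4 for small h, and Q(h - 1), Q(h + 1) >= 0 give
2 |A h + B| <= Q(h) + A, which is at most a constant times Q(h). *)
Lemma kernel_line_bound (p q c w A : R) : 0 < c -> q <= 0 -> w ^+ 2 <= A ->
  exists2 K, 0 <= K & forall B D h, c ^+ 2 <= D ->
    (forall t, 0 <= A * t ^+ 2 + 2 * B * t + D) -> `|h| < c / (2 * (1 + A)) ->
    [/\ 0 < h * w + c, 0 < A * h ^+ 2 + 2 * B * h + D &
    `|p * w * (h * w + c) `^ (p - 1) * (A * h ^+ 2 + 2 * B * h + D) `^ q
     + 2 * q * (A * h + B) * (h * w + c) `^ p * (A * h ^+ 2 + 2 * B * h + D) `^ (q - 1)|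
    <= K * D `^ q].
Proof.
move=> c0 q0 wA; have A0 : 0 <= A by exact: le_trans (sqr_ge0 w) wA.
pose c1 p := (c / 2) `^ p + (2 * c) `^ p : R.
have c1_ge0 r : 0 <= c1 r by rewrite addr_ge0 ?powR_ge0.
pose W := `|p * w| * c1 (p - 1) + `|q| * (1 + 4 * A / c ^+ 2) * c1 p.
have c2 : 0 < c ^+ 2 by exact: exprn_gt0.
have W0 : 0 <= W.
  rewrite addr_ge0// mulr_ge0// ?mulr_ge0//.
  by rewrite addr_ge0// divr_ge0 ?mulr_ge0// ltW.
exists (W * 4^-1 `^ q); first by rewrite mulr_ge0 ?powR_ge0.
move=> B D h cD pos hlt.
have D0 : 0 < D by exact: lt_le_trans cD.
have hA : h ^+ 2 * A <= c ^+ 2 / 4.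
  rewrite -real_normK ?num_real//.
  apply: (@le_trans _ _ ((c / (2 * (1 + A))) ^+ 2 * A)).
    by rewrite ler_wpM2r// ler_pXn2r ?nnegrE ?(ltW hlt)// (le_trans _ (ltW hlt)).
  have -> : (c / (2 * (1 + A))) ^+ 2 * A = c ^+ 2 / 4 * (A / (1 + A) ^+ 2).
    by field; rewrite gt_eqF// ltr_pwDl.
  rewrite ler_piMr ?divr_ge0 ?(ltW c2)// ler_pdivrMr ?exprn_gt0 ?ltr_pwDl// mul1r.
  by rewrite (_ : (1 + A) ^+ 2 = A + (1 + A + A ^+ 2)) ?lerDl ?addr_ge0 ?sqr_ge0//; ring.
have hw : `|h * w| <= c / 2.
  rewrite -(@ler_pXn2r _ 2)// ?nnegrE ?divr_ge0 ?(ltW c0)//.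
  rewrite real_normK ?num_real// exprMn expr_div_n (_ : 2 ^+ 2 = 4); last by rewrite -natrX.
  by rewrite (le_trans _ hA)// ler_wpM2l ?sqr_ge0.
move: hw; rewrite ler_norml => /andP[hw1 hw2].
have cl : c / 2 <= h * w + c by lra.
have cu : h * w + c <= 2 * c by lra.
have c20 : 0 < c / 2 by rewrite divr_gt0.
have cpos : 0 < h * w + c by exact: lt_le_trans cl.
set Q := A * h ^+ 2 + 2 * B * h + D.
have QD : D / 4 <= Q.
  have := pos (2 * h); rewrite exprMn (_ : 2 ^+ 2 = 4 :> R); last by rewrite -natrX.
  by rewrite /Q; nra.
have Q0 : 0 < Q by apply: lt_le_trans QD; rewrite divr_gt0.
split=> //.
have AQ : A <= 4 * A / c ^+ 2 * Q.
  apply: (@le_trans _ _ (4 * A / c ^+ 2 * (c ^+ 2 / 4))).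
    by rewrite le_eqVlt; apply/orP; left; apply/eqP; field; rewrite gt_eqF.
  apply: ler_wpM2l; first by rewrite divr_ge0 ?(ltW c2)// mulr_ge0.
  by rewrite (le_trans _ QD)// ler_wpM2r.
have ABQ : 2 * `|A * h + B| <= (1 + 4 * A / c ^+ 2) * Q.
  rewrite [leRHS]mulrDl mul1r; apply: (@le_trans _ _ (Q + A)); last by rewrite lerD2l.
  rewrite mulrC -ler_pdivlMr// ler_norml.
  have := pos (h + 1); have := pos (h - 1); rewrite /Q => ? ?.
  by apply/andP; split; lra.
have Qq : Q `^ q <= 4^-1 `^ q * D `^ q.
  by rewrite -powRM ?invr_ge0 ?(ltW D0)// [4^-1 * D]mulrC ler_npowR// divr_gt0.
have QE : Q * Q `^ (q - 1) = Q `^ q by exact: gt0_mul_powRB1.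
apply: (@le_trans _ _ (W * Q `^ q)); last by rewrite -(mulrA W) ler_wpM2l.
rewrite (le_trans (ler_normD _ _))// [leRHS]mulrDl; apply: lerD.
  rewrite !normrM (ger0_norm (powR_ge0 _ _)) (ger0_norm (powR_ge0 _ _)) -!normrM.
  rewrite ler_wpM2r ?powR_ge0// ler_wpM2l//; exact: powR_le_ends.
rewrite !normrM (ger0_norm (powR_ge0 _ _)) (ger0_norm (powR_ge0 _ _)).
rewrite (@ger0_norm _ 2)// -QE.
apply: (@le_trans _ _ (`|q| * ((1 + 4 * A / c ^+ 2) * Q) * c1 p * Q `^ (q - 1))).
  rewrite ler_wpM2r ?powR_ge0// ler_pM ?mulr_ge0 ?powR_ge0//; last exact: powR_le_ends.
  by rewrite mulrAC mulrC ler_wpM2l.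
by rewrite le_eqVlt; apply/orP; left; apply/eqP; ring.
Qed.

Lemma integrable_sqdist x (s : R) : half_space x -> 0 < s - d%:R / 2 ->
  mu.-integrable setT (EFin \o (fun y => sqdist x y `^ (- s))).
Proof.
move=> x0 sd; have c20 : 0 < normal_coord x ^+ 2 by exact: exprn_gt0.
exact: (integrable_sub_tuple d (tangential x) _ (integrable_radial d s _ c20 sd)).
Qed.

(** Otherwise the radial integrals would vanish. *)
Lemma lebesgue_tuple_setT_gt0 : (0 < mu setT)%E.
Proof.
rewrite lt0e measure_ge0 andbT; apply/eqP => mu0.
have s0 : 0 < d%:R / 2 + 1 - d%:R / 2 :> R by rewrite addrAC subrr add0r.
have := @integral_radial R d (d%:R / 2 + 1) 1 ltr01 s0.
rewrite null_set_integral//; last first.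
  by apply/measurable_EFinP; exact: measurable_radial_powR.
move=> [] /esym/eqP; rewrite gt_eqF// !mulr_gt0 ?powR_gt0 ?pi_gt0 ?invr_gt0 ?Gamma_gt0//.
Qed.

Lemma Lfun_inftyP (f : d.-tuple T -> R) : f \in Lfun mu +oo%E ->
  exists N, [/\ ('N[mu]_+oo [EFin \o f] = N%:E)%E, 0 <= N, measurable_fun setT f
    & {ae mu, forall y, `|f y| <= N}].
Proof.
move=> fL.
have mf : measurable_fun setT f by have := sub_Lfun_mfun fL; rewrite inE.
have := sub_Lfun_finLfun fL; rewrite inE/= /finite_norm => fin.
have N0 := Lnorm_ge0 mu +oo%E (EFin \o f).
exists (fine ('N[mu]_+oo [EFin \o f])%E); have Nfin : ('N[mu]_+oo [EFin \o f])%E \is a fin_num.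
  by rewrite ge0_fin_numE.
split=> //; [by rewrite fineK|by rewrite fine_ge0|].
have := ess_sup_ge mu (abse \o (EFin \o f)).
apply: filterS => y; rewrite /= -lee_fin fineK// => /le_trans; apply.
by rewrite unlock lebesgue_tuple_setT_gt0.
Qed.

Lemma integrable_mul_bounded (g f : d.-tuple T -> R) (N : R) : 0 <= N ->
  mu.-integrable setT (EFin \o g) -> measurable_fun setT f ->
  {ae mu, forall y, `|f y| <= N} ->
  mu.-integrable setT (EFin \o (fun y => g y * f y)) /\
  \int[mu]_y `|g y * f y| <= N * \int[mu]_y `|g y|.
Proof.
move=> N0 ig mf fN; have mg : measurable_fun setT g.
  by apply/measurable_EFinP; exact: measurable_int ig.
have mgf : measurable_fun setT (fun y => g y * f y) by exact: measurable_funM.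
have le : (\int[mu]_y (`|g y * f y|)%:E <= N%:E * \int[mu]_y (`|g y|)%:E)%E.
  rewrite -ge0_integralZl_real//; last exact: measurableT_comp.
  apply: ae_ge0_le_integral => //.
  - by apply/measurable_EFinP; exact: measurableT_comp.
  - by move=> y _; rewrite lee_fin mulr_ge0.
  - apply/measurable_EFinP; apply: measurable_funM => //; exact: measurableT_comp.
  - by apply: filterS fN => y fyN _; rewrite lee_fin normrM mulrC ler_wpM2r.
have ign := integrable_norm ig.
have [_ gfin] := integrableP _ _ _ ig.
have igf : mu.-integrable setT (EFin \o (fun y => g y * f y)).
  apply/integrableP; split; first exact/measurable_EFinP.
  by rewrite (le_lt_trans le)// lte_mul_pinfty// ?lee_fin.
split=> //; rewrite -lee_fin EFinM /Rintegral !fineK//.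
- exact: (integrable_fin_num measurableT ign).
- exact: (integrable_fin_num measurableT (integrable_norm igf)).
Qed.

End kernel.

(** * Differentiation of the potential *)

Lemma scalerB_factor {R : realType} (k a I J : R) :
  a *: (k * I - k * J) = k * (a *: (I - J)).
Proof. by rewrite -mulrBr /GRing.scale/= mulrCA. Qed.

Section potential_derivative.
Context {R : realType} (n : nat).
Local Notation d := (n.-1).
Local Notation T := (measurableTypeR R).
Local Notation mu := (@lebesgue_tuple R d).
Implicit Types (x v : 'rV[R]_(d + 1)) (y : d.-tuple T).

Definition direction_kernel (alpha beta : R) x v y : R :=
  gradient_kernel d alpha beta (normal_coord x) (normal_coord v) (tangential n v)
    (offset n x y).

Lemma integrable_direction_kernel alpha beta x v : half_space x -> d%:R < beta ->
  mu.-integrable setT (EFin \o direction_kernel alpha beta x v).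
Proof.
move=> x0 bd; apply: (integrable_sub_tuple d (tangential n x)).
exact: integrable_gradient_kernel.
Qed.

(** The derivative supplied by [is_derive_kernel_line] at h = 0, with
p = alpha beta and q = - beta / 2, is a multiple of the directional kernel. *)
Lemma direction_kernelE (alpha beta : R) x v y : half_space x ->
  let c := normal_coord x in let D := sqdist n x y in
  let B := normal_coord v * c + dot_tuple d (tangential n v) (offset n x y) in
  alpha * beta * normal_coord v * c `^ (alpha * beta - 1) * D `^ (- (beta / 2)) +
  2 * (- (beta / 2)) * B * c `^ (alpha * beta) * D `^ (- (beta / 2) - 1) =
  beta * c `^ (alpha * beta - 1) * direction_kernel alpha beta x v y.
Proof.
move=> x0 c D B; have D0 : 0 < D := sqdist_gt0 n x y x0.
have c0 : 0 < c by [].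
have -> : D `^ (- (beta / 2)) = D * D `^ (- (beta / 2) - 1).
  by rewrite gt0_mul_powRB1.
have -> : c `^ (alpha * beta) = c * c `^ (alpha * beta - 1).
  by rewrite gt0_mul_powRB1.
rewrite /direction_kernel /gradient_kernel /radial_weight -/c -/(sqdist n x y) -/D.
rewrite (_ : - (beta / 2 + 1) = - (beta / 2) - 1); last by ring.
rewrite /B; move: (dot_tuple _ _ _) (D `^ _) (c `^ _) (normal_coord v) => E X Y w.
by field.
Qed.

(** Differentiation under the integral sign along the line h |-> x + h v. The
formula [potential_kernelE] holds inside the half-space only, so h is confined to
|h| < delta, where [kernel_line_bound] keeps the line inside and dominates the
derivative. *)
Lemma is_derive_potential (k alpha beta : R) (f : d.-tuple T -> R) x v :
  half_space x -> d%:R < beta -> f \in Lfun mu +oo%E ->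
  is_derive x v (potential n k alpha beta f)
    (k * (beta * normal_coord x `^ (alpha * beta - 1)) *
     \int[mu]_y (direction_kernel alpha beta x v y * f y)).
Proof.
move=> x0 bd fL; have [N [_ N0 mf fN]] := Lfun_inftyP n f fL.
have b0 : 0 < beta by exact: le_lt_trans bd.
pose c := normal_coord x; have c0 : 0 < c by [].
pose w := normal_coord v; pose A := \sum_i v 0 i ^+ 2.
pose B y := w * c + dot_tuple d (tangential n v) (offset n x y).
pose p := alpha * beta; pose q := - (beta / 2).
have q0 : q <= 0 by rewrite oppr_le0 divr_ge0 ?ltW.
have wA : w ^+ 2 <= A.
  rewrite /A (sum_coordE n (fun t => t ^+ 2)) lerDr sumr_ge0// => i _; exact: sqr_ge0.
have A0 : 0 <= A by exact: le_trans (sqr_ge0 w) wA.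
have [K K0 HK] := kernel_line_bound p q c w A c0 q0 wA.
pose delta := c / (2 * (1 + A)).
have delta0 : 0 < delta by rewrite divr_gt0// mulr_gt0// ltr_pwDl.
pose Q y h := A * h ^+ 2 + 2 * B y * h + sqdist n x y.
have QE y h : sqdist n (h *: v + x) y = Q y h by exact: sqdist_line.
have Qpos y t : 0 <= Q y t by rewrite -QE addr_ge0 ?sqr_ge0 ?sqnorm_tuple_ge0.
have inI h : h \in `](- delta), delta[ -> `|h| < delta.
  by rewrite in_itv/= ltr_norml.
pose psi h y := (normal_coord (h *: v + x) `^ alpha /
  enorm (boundary_point y - (h *: v + x))) `^ beta * f y.
pose der h y := p * w * (h * w + c) `^ (p - 1) * Q y h `^ q
     + 2 * q * (A * h + B y) * (h * w + c) `^ p * Q y h `^ (q - 1).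
(* Any boundary point serves here; the origin is used. *)
have hs h : h \in `](- delta), delta[ -> half_space (h *: v + x).
  move=> /inI hI; have [+ _ _] := HK (B [tuple 0 | i < d]) (sqdist n x [tuple 0 | i < d]) h
    (sqdist_ge n x _) (Qpos _) hI.
  by rewrite /half_space/= normal_coord_line.
have psiE h y : h \in `](- delta), delta[ -> psi h y = (h * w + c) `^ p * Q y h `^ q * f y.
  by move=> hI; rewrite /psi (potential_kernelE n _ _ _ _ (hs h hI)) QE normal_coord_line.
have dpsi h y : h \in `](- delta), delta[ -> is_derive h 1 (psi ^~ y) (der h y * f y).
  move=> hI.
  have [h1 h2 _] := HK (B y) (sqdist n x y) h (sqdist_ge n x y) (Qpos y) (inI h hI).
  have dk := is_derive_kernel_line p q c w A (B y) (sqdist n x y) h h1 h2.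
  have dkf : is_derive h 1 (fun h : R => (h * w + c) `^ p * Q y h `^ q * f y) (der h y * f y).
    by apply: is_derive_eq; rewrite /GRing.scale/= mulr0 add0r mulrC.
  apply: near_eq_is_derive dkf.
  by have := near_in_itvoo hI; apply: filterS => t tI; rewrite psiE.
have q_int : 0 < beta / 2 - d%:R / 2 by rewrite -mulrBl divr_gt0// subr_gt0.
have ipsi h : `](- delta), delta[%classic h -> mu.-integrable setT (EFin \o psi h).
  move=> hI; have hsh := hs h hI.
  have ig : mu.-integrable setT (EFin \o
      (fun y => normal_coord (h *: v + x) `^ (alpha * beta) * sqdist n (h *: v + x) y `^ q)).
    have := integrableZl measurableT (normal_coord (h *: v + x) `^ (alpha * beta))
      (integrable_sqdist n (h *: v + x) (beta / 2) hsh q_int).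
    exact: eq_integrable.
  have [+ _] := integrable_mul_bounded n _ f N N0 ig mf fN.
  by apply: eq_integrable => // y _; rewrite /psi/= (potential_kernelE n _ _ _ _ hsh).
pose G y := `|K * sqdist n x y `^ q * f y|.
have iG : mu.-integrable setT (EFin \o G).
  apply: integrable_norm.
  have ig : mu.-integrable setT (EFin \o (fun y => K * sqdist n x y `^ q)).
    have := integrableZl measurableT K (integrable_sqdist n x (beta / 2) x0 q_int).
    exact: eq_integrable.
  by have [] := integrable_mul_bounded n _ f N N0 ig mf fN.
have zI : `](- delta), delta[%classic 0 by rewrite /= in_itv/= oppr_lt0 delta0.
have psi_der h y : `](- delta), delta[%classic h -> setT y -> derivable (psi ^~ y) h 1.
  by move=> hI _; have [] := dpsi h y hI.
have psi_bound h y : `](- delta), delta[%classic h -> setT y -> `|partial1of2 psi h y| <= G y.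
  move=> hI _; rewrite partial1of2E; have [_ ->] := dpsi h y hI.
  rewrite /G !normrM ler_wpM2r// -normrM.
  rewrite [leRHS]ger0_norm ?mulr_ge0 ?powR_ge0//.
  by have [] := HK (B y) (sqdist n x y) h (sqdist_ge n x y) (Qpos y) (inI h hI).
have lim := cvg_differentiation_under_integral measurableT zI ipsi psi_der
  (fun y => normr_ge0 _) iG psi_bound.
pose L := k * (beta * c `^ (alpha * beta - 1)) *
  \int[mu]_y (direction_kernel alpha beta x v y * f y).
have limE : k * (\int[mu]_y partial1of2 psi 0 y) = L.
  rewrite /L -!mulrA; congr (k * _); rewrite !mulrA.
  have [idk _] := integrable_mul_bounded n _ f N N0
    (integrable_direction_kernel alpha beta x v x0 bd) mf fN.
  rewrite -RintegralZl//; apply: eq_Rintegral => y _.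
  rewrite partial1of2E; have [_ ->] := dpsi 0 y zI.
  rewrite mulrA -direction_kernelE// /der /Q -/c -/w -/p -/q -/(B y).
  by rewrite mul0r add0r expr0n/= !mulr0 !add0r.
have cvgu : h^-1 *: ((potential n k alpha beta f \o shift x) (h *: v)
    - potential n k alpha beta f x) @[h --> 0^'] --> L.
  rewrite -limE.
  rewrite (_ : (fun h => _) = (fun h : R => k *
      (h^-1 *: (\int[mu]_y psi (h + 0) y - \int[mu]_y psi 0 y)))).
    exact: cvgMl_tmp lim.
  have potE h : potential n k alpha beta f (h *: v + x) = k * \int[mu]_y psi h y.
    reflexivity.
  have potE0 := potE 0; rewrite scale0r add0r in potE0.
  apply/funext => h; rewrite potE0 [X in _ *: (X - _)]potE addr0.
  exact: scalerB_factor.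
apply: DeriveDef; first by apply/cvg_ex; exists L.
exact/cvg_lim.
Qed.

End potential_derivative.

(** * The bound on the gradient *)

Lemma linear_form_delta {R : realType} m (L : 'rV[R]_m -> R) (v : 'rV[R]_m) :
  (forall a u w, L (a *: u + w) = a * L u + L w) ->
  L v = \sum_i v 0 i * L (delta_mx 0 i).
Proof.
move=> linL.
have L0 : L 0 = 0 by have := linL (- 1) 0 0; rewrite scaler0 addr0 mulN1r addNr.
rewrite {1}(row_sum_delta v).
by apply: (big_rec2 (fun u s => L u = s)) => // i u s _ E; rewrite linL E.
Qed.

Lemma enorm_sqr {R : realType} m (v : 'rV[R]_m) : enorm v ^+ 2 = \sum_i v 0 i ^+ 2.
Proof. by rewrite sqr_sqrtr// sumr_ge0// => i _; exact: sqr_ge0. Qed.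

Lemma norm_coord_le_enorm {R : realType} m (v : 'rV[R]_m) i : `|v 0 i| <= enorm v.
Proof.
rewrite -sqrtr_sqr ler_sqrt ?sqr_ge0//; last first.
  by rewrite sumr_ge0// => j _; exact: sqr_ge0.
by rewrite (bigD1 i)//= lerDl sumr_ge0// => j _; exact: sqr_ge0.
Qed.

Section gradient_bound.
Context {R : realType} (n : nat).
Local Notation d := (n.-1).
Local Notation T := (measurableTypeR R).
Local Notation mu := (@lebesgue_tuple R d).
Implicit Types (x v : 'rV[R]_(d + 1)) (y : d.-tuple T).
Variables (k alpha beta : R).
Hypotheses (al1 : 1 <= alpha) (bd : d%:R < beta).

Lemma direction_kernel_linear x (a : R) v w y :
  direction_kernel n alpha beta x (a *: v + w) y =
  a * direction_kernel n alpha beta x v y + direction_kernel n alpha beta x w y.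
Proof.
rewrite /direction_kernel /gradient_kernel normal_coord_line.
have -> : dot_tuple d (tangential n (a *: v + w)) (offset n x y) =
    a * dot_tuple d (tangential n v) (offset n x y) +
    dot_tuple d (tangential n w) (offset n x y).
  rewrite /dot_tuple mulr_sumr -big_split/=; apply: eq_bigr => i _.
  by rewrite /tangential !mxE; ring.
by ring.
Qed.

Lemma direction_integral_linear x (f : d.-tuple T -> R) : half_space x ->
  f \in Lfun mu +oo%E -> forall a v w,
  \int[mu]_y (direction_kernel n alpha beta x (a *: v + w) y * f y) =
  a * \int[mu]_y (direction_kernel n alpha beta x v y * f y) +
  \int[mu]_y (direction_kernel n alpha beta x w y * f y).
Proof.
move=> x0 fL a v w; have [N [_ N0 mf fN]] := Lfun_inftyP n f fL.
have int u : mu.-integrable setT (EFin \o (fun y => direction_kernel n alpha beta x u y * f y)).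
  have ik := integrable_direction_kernel n alpha beta x u x0 bd.
  by have [] := integrable_mul_bounded n _ f N N0 ik mf fN.
have intZ : mu.-integrable setT
    (EFin \o (fun y => a * (direction_kernel n alpha beta x v y * f y))).
  by have := integrableZl measurableT a (int v); exact: eq_integrable.
rewrite -RintegralZl// -RintegralD//; apply: eq_Rintegral => y _.
by rewrite direction_kernel_linear mulrDl mulrA.
Qed.

Definition gradient_scale x : R := k * (beta * normal_coord x `^ (alpha * beta - 1)).

Lemma gradientE x (f : d.-tuple T -> R) i : half_space x -> f \in Lfun mu +oo%E ->
  gradient (potential n k alpha beta f) x 0 i =
  gradient_scale x * \int[mu]_y (direction_kernel n alpha beta x (delta_mx 0 i) y * f y).
Proof.
move=> x0 fL; rewrite mxE.
by have [_ ->] := is_derive_potential n k alpha beta f x (delta_mx 0 i) x0 bd fL.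
Qed.

Lemma measurable_gradient_kernel c zn z :
  d%:R < beta -> 0 < c -> measurable_fun setT (gradient_kernel d alpha beta c zn z).
Proof.
move=> bd' c0; apply/measurable_EFinP.
exact: measurable_int (integrable_gradient_kernel d alpha beta c bd' c0 z zn).
Qed.

Hypothesis ratio : 2 * Gamma ((beta - d%:R) / 2 + 2^-1) <=
  (alpha - 1) / (1 + Num.sqrt (1 + (alpha - 1) ^+ 2)) *
  (Num.sqrt pi * (beta * (alpha - 1) + d%:R) * Gamma ((beta - d%:R) / 2)).

Lemma direction_kernel_mass_le x v : half_space x ->
  \int[mu]_y `|direction_kernel n alpha beta x v y| <=
  enorm v * kernel_mass d alpha beta (normal_coord x).
Proof.
move=> x0.
rewrite (Rintegral_sub_tuple d (tangential n x)
  (fun y => `|gradient_kernel d alpha beta (normal_coord x) (normal_coord v) (tangential n v) y|)).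
- rewrite /enorm (sum_coordE n (fun t => t ^+ 2)).
  exact: Rintegral_gradient_kernel_le.
- by apply: measurableT_comp => //; exact: measurable_gradient_kernel.
- by move=> y.
Qed.

(** The gradient G satisfies |G|^2 = kappa L(G), where L(v) is the integral of f against
the directional kernel; bounding |L(G)| by the L^1 norm of the kernel in the direction
G gives |G|^2 <= C |G|. No direction has to be maximized over. *)
Lemma enorm_gradient_le x (f : d.-tuple T -> R) N : half_space x ->
  f \in Lfun mu +oo%E -> ('N[mu]_+oo [EFin \o f] = N%:E)%E ->
  enorm (gradient (potential n k alpha beta f) x) <=
  `|gradient_scale x| * kernel_mass d alpha beta (normal_coord x) * N.
Proof.
move=> x0 fL fN; have [N' [fN' N0 mf fle]] := Lfun_inftyP n f fL.
move: fN'; rewrite fN => -[NN']; rewrite -NN' in N0 fle.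
set G := gradient _ x; set M := kernel_mass _ _ _ _; set kappa := gradient_scale x.
have M0 : 0 <= M by exact: kernel_mass_ge0.
pose L v := \int[mu]_y (direction_kernel n alpha beta x v y * f y).
have linL : forall a u w, L (a *: u + w) = a * L u + L w by exact: direction_integral_linear.
have E0 : 0 <= enorm G by exact: sqrtr_ge0.
have GE : enorm G ^+ 2 = kappa * L G.
  rewrite enorm_sqr (linear_form_delta _ L G linL) mulr_sumr; apply: eq_bigr => i _.
  by rewrite expr2 {1}/G gradientE// -/kappa -/(L _) mulrC mulrCA.
have LG : `|L G| <= N * (enorm G * M).
  have ik := integrable_direction_kernel n alpha beta x G x0 bd.
  have [ikf le] := integrable_mul_bounded n _ f N N0 ik mf fle.
  rewrite (le_trans (le_normr_Rintegral measurableT ikf))// (le_trans le)//.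
  by rewrite ler_wpM2l// direction_kernel_mass_le.
have [G0|Gneq0] := eqVneq (enorm G) 0.
  by rewrite G0 (mulr_ge0 (mulr_ge0 (normr_ge0 kappa) M0) N0).
have Ggt0 : 0 < enorm G by rewrite lt_neqAle eq_sym Gneq0.
rewrite -(ler_pM2l Ggt0) -expr2 GE (le_trans (ler_norm _))// normrM.
apply: (@le_trans _ _ (`|kappa| * (N * (enorm G * M)))); first by rewrite ler_wpM2l.
by rewrite le_eqVlt; apply/orP; left; apply/eqP; ring.
Qed.

Lemma cst1_Lfun_infty :
  (cst 1 : d.-tuple T -> R) \in Lfun mu +oo%E /\
  ('N[mu]_+oo [EFin \o (cst 1%R : d.-tuple T -> R)] = 1)%E.
Proof.
have N1 : ('N[mu]_+oo [EFin \o (cst 1%R : d.-tuple T -> R)] = 1)%E.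
  rewrite unlock lebesgue_tuple_setT_gt0.
  rewrite (_ : abse \o _ = cst 1%E); first exact: ess_sup_cst (lebesgue_tuple_setT_gt0 n).
  by apply/funext => y /=; rewrite normr1.
split=> //; rewrite inE; apply/andP; split; rewrite inE//=.
by rewrite /finite_norm N1 ltry.
Qed.

Lemma normal_derivative_cst1 x : half_space x ->
  normal_derivative (potential n k alpha beta (cst 1)) x =
  gradient_scale x * kernel_mass d alpha beta (normal_coord x).
Proof.
move=> x0; have [f1 _] := cst1_Lfun_infty.
rewrite /normal_derivative.
have [_ ->] := is_derive_potential n k alpha beta _ x (delta_mx 0 (rshift d 0)) x0 bd f1.
congr (_ * _).
have nn : normal_coord (n := n) (delta_mx 0 (rshift d 0) : 'rV[R]_(d + 1)) = 1.
  by rewrite /normal_coord mxE !eqxx.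
have tt : tangential n (delta_mx 0 (rshift d 0) : 'rV[R]_(d + 1)) = fun=> 0.
  by apply/funext => i; rewrite /tangential mxE eqxx eq_lrshift.
have c0 : 0 < normal_coord x by [].
rewrite -(Rintegral_normal_kernel d alpha beta (normal_coord x) bd c0).
pose g y := (alpha * (normal_coord x ^+ 2 + sqnorm_tuple d y) - normal_coord x ^+ 2)
  * radial_weight d beta (normal_coord x) y.
rewrite -(Rintegral_sub_tuple d (tangential n x) g).
- apply: eq_Rintegral => y _; rewrite mulr1 /direction_kernel gradient_kernelE nn tt.
  rewrite mul1r (_ : dot_tuple d _ _ = 0) ?mulr0 ?mul0r ?subr0//.
  by rewrite /dot_tuple big1// => i _; rewrite mul0r.
- apply/measurable_EFinP; exact: measurable_int (integrable_normal_kernel d alpha beta _ bd c0).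
- move=> y; rewrite mulr_ge0 ?radial_weight_ge0// subr_ge0.
  rewrite (@le_trans _ _ (1 * (normal_coord x ^+ 2 + sqnorm_tuple d y)))//.
    by rewrite mul1r lerDl sqnorm_tuple_ge0.
  by rewrite ler_wpM2r// addr_ge0 ?sqr_ge0 ?sqnorm_tuple_ge0.
Qed.

End gradient_bound.

Section sharpness.
Context {R : realType} (n : nat).
Local Notation mu := (@lebesgue_tuple R n.-1).
Local Notation bfun := (n.-1.-tuple (measurableTypeR R) -> R).

(** The constant 1 has norm 1 and attains the bound. *)
Lemma sharp_and_sup_attained_cst1 (Q : bfun -> R) (C : R) :
  (forall f N, f \in Lfun mu +oo%E -> ('N[mu]_+oo [EFin \o f] = N%:E)%E -> Q f <= C * N) ->
  Q (cst 1) = C -> 0 <= C -> sharp_coefficient n Q C /\ unit_ball_sup n Q = C%:E.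
Proof.
move=> Qle Q1 C0; have [L1 N1] := @cst1_Lfun_infty R n.
split; first split.
- move=> f fL; have [N [fN N0 _ _]] := Lfun_inftyP n f fL.
  by rewrite fN -EFinM lee_fin; exact: Qle.
- move=> c /(_ _ L1); rewrite N1 mule1 lee_fin Q1; exact.
apply/eqP; rewrite eq_le; apply/andP; split.
  apply: ge_ereal_sup => _ [f [fL f1] <-].
  have [N [fN N0 _ _]] := Lfun_inftyP n f fL.
  rewrite lee_fin (le_trans (Qle f N fL fN))//.
  by move: f1; rewrite fN lee_fin => N_le1; rewrite ler_piMr.
apply: ereal_sup_ubound; exists (cst 1); last by rewrite Q1.
by split=> //; rewrite le_eqVlt; apply/orP; left; apply/eqP; exact: N1.
Qed.

End sharpness.

(** * The critical exponent *)

Section critical_exponent.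
Context {R : realType}.

(** tan (arctan t / 2). *)
Definition half_angle_tan (t : R) : R := t / (1 + Num.sqrt (1 + t ^+ 2)).

Lemma half_angle_tan_den_gt0 (t : R) : 0 < 1 + Num.sqrt (1 + t ^+ 2).
Proof. by rewrite ltr_pwDl// sqrtr_ge0. Qed.

Lemma half_angle_tan_ge0 t : 0 <= t -> 0 <= half_angle_tan t.
Proof. by move=> t0; rewrite divr_ge0// ltW// half_angle_tan_den_gt0. Qed.

Lemma half_angle_tan_incr s t : 0 <= s -> s < t -> half_angle_tan s < half_angle_tan t.
Proof.
move=> s0 st; have t0 : 0 < t by exact: le_lt_trans st.
rewrite /half_angle_tan ltr_pdivrMr ?half_angle_tan_den_gt0// mulrAC.
rewrite ltr_pdivlMr ?half_angle_tan_den_gt0// !mulrDr !mulr1 ltr_leD//.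
rewrite -(@ler_pXn2r _ 2)// ?nnegrE ?mulr_ge0 ?sqrtr_ge0 ?(ltW t0)//.
have pos (r : R) : 0 <= 1 + r ^+ 2 by rewrite addr_ge0// sqr_ge0.
rewrite !exprMn !sqr_sqrtr// !mulrDr !mulr1 (mulrC (t ^+ 2)) lerD2r.
by rewrite ler_pXn2r ?nnegrE ?(ltW st) ?(ltW t0).
Qed.

Lemma continuous_half_angle_tan : continuous half_angle_tan.
Proof.
move=> t; apply: cvgM; first exact: cvg_id.
apply: cvgV; first by rewrite gt_eqF// half_angle_tan_den_gt0.
apply: cvgD; first exact: cvg_cst.
apply: (@continuous_comp _ _ _ (fun t : R => 1 + t ^+ 2) Num.sqrt).
  by apply: cvgD; [exact: cvg_cst|exact: exprn_continuous].
exact: sqrt_continuous.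
Qed.

Variables (beta e P K : R).
Hypotheses (b0 : 0 < beta) (e0 : 0 <= e) (P0 : 0 < P) (K0 : 0 < K).

(** With t = alpha - 1, e = d and P = sqrt pi Gamma ((beta - d) / 2), the equation for
alpha_n reads critical_fun t = 2 Gamma ((beta - d + 1) / 2). As a product of an
increasing and a positive increasing function, the left-hand side is increasing. *)
Definition critical_fun (t : R) : R := half_angle_tan t * (P * (beta * t + e)).

Lemma critical_fun_incr s t : 0 <= s -> s < t -> critical_fun s < critical_fun t.
Proof.
move=> s0 st; have t0 : 0 < t by exact: le_lt_trans st.
rewrite /critical_fun; apply: (@le_lt_trans _ _ (half_angle_tan s * (P * (beta * t + e)))).
  rewrite ler_wpM2l ?half_angle_tan_ge0// ler_wpM2l ?(ltW P0)// lerD2r.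
  by rewrite ler_wpM2l// ltW.
rewrite ltr_pM2r ?half_angle_tan_incr// mulr_gt0// ltr_wpDr// mulr_gt0//.
Qed.

Lemma critical_fun_root : exists2 t, 0 < t & critical_fun t = K.
Proof.
(* tan (arctan b / 2) >= 1 / 3 for b >= 1, and b is large enough for
   P beta b / 3 >= K. *)
pose b := 1 + 3 * K / (P * beta).
have b1 : 1 <= b by rewrite lerDl divr_ge0 ?mulr_ge0 ?ltW.
have b_ge0 : 0 <= b by exact: le_trans b1.
have f0 : critical_fun 0 = 0 by rewrite /critical_fun /half_angle_tan !mul0r.
have T3 : 3^-1 <= half_angle_tan b.
  apply: (@le_trans _ _ (half_angle_tan 1)).
    rewrite /half_angle_tan expr1n mul1r lef_pV2 ?posrE ?ltr_pwDl ?sqrtr_ge0//.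
    have s2 : Num.sqrt (1 + 1) <= 2 :> R.
      rewrite -[leRHS](@ger0_norm _ 2)// -sqrtr_sqr ler_sqrt ?sqr_ge0//.
      by rewrite expr2; lra.
    by move: s2; lra.
  have [<-//|b1'] := eqVneq 1 b.
  by apply: ltW; apply: half_angle_tan_incr => //; rewrite lt_neqAle b1'.
have fb : K <= critical_fun b.
  apply: (@le_trans _ _ (3^-1 * (P * (beta * b + e)))); last first.
    by rewrite ler_wpM2r// mulr_ge0 ?(ltW P0)// addr_ge0// mulr_ge0// ltW.
  have -> : 3^-1 * (P * (beta * b + e)) = K + 3^-1 * P * (beta + e).
    by rewrite /b; field; rewrite !gt_eqF.
  by rewrite lerDl mulr_ge0 ?mulr_ge0 ?addr_ge0 ?(ltW P0) ?(ltW b0)// invr_ge0.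
have cf : {within `[0, b], continuous critical_fun}.
  apply: continuous_subspaceT => t; apply: cvgM; first exact: continuous_half_angle_tan.
  apply: cvgMl_tmp; apply: cvgD; last exact: cvg_cst.
  by apply: cvgMl_tmp; exact: cvg_id.
have [|t] := @IVT R critical_fun 0 b K b_ge0 cf.
  by rewrite f0 ge_min le_max (ltW K0) fb orbT.
rewrite in_itv/= => /andP[t0 _] ft; exists t => //.
by rewrite lt_neqAle t0 andbT; apply/eqP => t00; move: K0; rewrite -ft -t00 f0 ltxx.
Qed.

Lemma critical_fun_root_uniq s t : 0 <= s -> 0 <= t ->
  critical_fun s = K -> critical_fun t = K -> s = t.
Proof.
move=> s0 t0 fs ft; have [st|ts|//] := ltgtP s t.
- by have := critical_fun_incr s t s0 st; rewrite fs ft ltxx.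
- by have := critical_fun_incr t s t0 ts; rewrite fs ft ltxx.
Qed.

End critical_exponent.

Section alpha_n.
Context {R : realType} (n : nat) (beta : R).
Hypotheses (n1 : (0 < n)%N) (bd : n.-1%:R < beta).
Local Notation u := ((beta - n.-1%:R) / 2).

Lemma n_pred : n%:R = n.-1%:R + 1 :> R.
Proof. by rewrite natr1 prednK. Qed.

Lemma is_alpha_nE (a : R) : is_alpha_n n beta a <->
  1 < a /\ critical_fun beta n.-1%:R (Num.sqrt pi * Gamma u) (a - 1) =
           2 * Gamma (u + 2^-1).
Proof.
have u0 : 0 < u by rewrite divr_gt0// subr_gt0.
have b0 : 0 < beta by exact: le_lt_trans bd.
have G0 := Gamma_gt0 u u0.
have sp : 0 < Num.sqrt (pi : R) by rewrite sqrtr_gt0 pi_gt0.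
rewrite /is_alpha_n n_pred.
have -> : (beta - (n.-1%:R + 1)) / 2 + 1 = u + 2^-1 by field.
have -> : (beta - (n.-1%:R + 1) + 1) / 2 = u by field.
have aux : 1 < a -> 0 < Num.sqrt pi * (beta * (a - 1) + (n.-1%:R + 1) - 1) * Gamma u.
  move=> a1; rewrite !mulr_gt0// addrA addrK ltr_wpDr// mulr_gt0// subr_gt0//.
split=> -[a1 E]; split=> //.
- rewrite /critical_fun /half_angle_tan -E.
  rewrite [X in _ / X * _](_ : _ = Num.sqrt pi * Gamma u * (beta * (a - 1) + n.-1%:R));
    last by ring.
  rewrite divfK// mulf_neq0//; first by rewrite mulf_neq0// gt_eqF.
  by rewrite gt_eqF// ltr_wpDr// mulr_gt0// subr_gt0.
- rewrite -E /critical_fun /half_angle_tan -[RHS]mulr1 -mulrA; congr (_ * _).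
  rewrite [X in _ * _ / X](_ : _ = Num.sqrt pi * Gamma u * (beta * (a - 1) + n.-1%:R));
    last by ring.
  rewrite mulfV// mulf_neq0//; first by rewrite mulf_neq0// gt_eqF.
  by rewrite gt_eqF// ltr_wpDr// mulr_gt0// subr_gt0.
Qed.

Lemma exists_unique_alpha_n : exists! a : R, is_alpha_n n beta a.
Proof.
have u0 : 0 < u by rewrite divr_gt0// subr_gt0.
have b0 : 0 < beta by exact: le_lt_trans bd.
have P0 : 0 < Num.sqrt pi * Gamma u.
  by rewrite mulr_gt0 ?Gamma_gt0// sqrtr_gt0 pi_gt0.
have K0 : 0 < 2 * Gamma (u + 2^-1) by rewrite mulr_gt0// Gamma_gt0// addr_gt0.
have e0 : 0 <= n.-1%:R :> R by [].
have [t t0 ft] := critical_fun_root beta _ _ _ b0 e0 P0 K0.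
exists (t + 1); split.
  by apply/is_alpha_nE; rewrite addrK ltrDr.
move=> a /is_alpha_nE[a1 fa]; apply/eqP; rewrite eq_sym -subr_eq; apply/eqP.
apply: (critical_fun_root_uniq beta _ _ _ b0 e0 P0 (a - 1) t _ _ fa ft) => //.
by rewrite subr_ge0 ltW.
by rewrite ltW.
Qed.

Lemma alpha_n_ratio an alpha : is_alpha_n n beta an -> an <= alpha ->
  2 * Gamma (u + 2^-1) <=
  (alpha - 1) / (1 + Num.sqrt (1 + (alpha - 1) ^+ 2)) *
  (Num.sqrt pi * (beta * (alpha - 1) + n.-1%:R) * Gamma u).
Proof.
move=> /is_alpha_nE[an1 <-] le_an.
have u0 : 0 < u by rewrite divr_gt0// subr_gt0.
have b0 : 0 < beta by exact: le_lt_trans bd.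
have P0 : 0 < Num.sqrt pi * Gamma u.
  by rewrite mulr_gt0 ?Gamma_gt0// sqrtr_gt0 pi_gt0.
have e0 : 0 <= n.-1%:R :> R by [].
rewrite [leRHS](_ : _ = critical_fun beta n.-1%:R (Num.sqrt pi * Gamma u) (alpha - 1)).
  2: by rewrite /critical_fun /half_angle_tan; congr (_ * _); exact: mulrAC.
move: le_an; rewrite le_eqVlt => /predU1P[->//|lt_an].
apply/ltW/critical_fun_incr => //; first by rewrite subr_ge0 ltW.
by rewrite ltrD2r.
Qed.

End alpha_n.

(** * The sharp coefficient *)

Lemma C_inftyE {R : realType} (n : nat) (k alpha beta : R) (x : 'rV[R]_(n.-1 + 1)) :
  (0 < n)%N -> n.-1%:R < beta -> half_space x ->
  `|gradient_scale n k alpha beta x| * kernel_mass n.-1 alpha beta (normal_coord x) =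
  C_infty n k alpha beta / normal_coord x `^ (2 - n%:R + beta * (1 - alpha)).
Proof.
move=> n0 bd x0; set c := normal_coord x; have c0 : 0 < c by [].
have b0 : 0 < beta by exact: le_lt_trans bd.
have g0 : Gamma (beta / 2) != 0 by rewrite gt_eqF// Gamma_gt0// divr_gt0.
rewrite /gradient_scale /kernel_mass /C_infty (n_pred n n0) -/c.
rewrite !normrM (gtr0_norm b0) (ger0_norm (powR_ge0 _ _)).
have -> : (n.-1%:R + 1 - 1) / 2 = n.-1%:R / 2 :> R by rewrite addrK.
have -> : (beta - (n.-1%:R + 1) + 1) / 2 = (beta - n.-1%:R) / 2 by field.
have -> : c `^ (2 - (n.-1%:R + 1) + beta * (1 - alpha)) =
    (c `^ (alpha * beta - 1) * (c ^+ 2) `^ (- ((beta - n.-1%:R) / 2)))^-1.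
  rewrite -(powR_mulrn 2 (ltW c0)) -powRrM -powRD ?(gt_eqF c0) ?implybT// -powRN.
  by congr (_ `^ _); field.
rewrite invrK.
move: (c `^ _) ((c ^+ 2) `^ _) (pi `^ _) (Gamma ((beta - _) / 2)) (Gamma (beta / 2)) g0.
by move=> X Y Z G H H0; field; rewrite H0 gt_eqF.
Qed.

Theorem theorem4 (R : realType) (n : nat) (k beta : R) :
  (3 <= n)%N -> n%:R - 1 < beta ->
  (exists! a : R, is_alpha_n n beta a) /\
  forall alpha_n alpha : R, is_alpha_n n beta alpha_n -> alpha_n <= alpha ->
  forall x : 'rV[R]_(n.-1 + 1), half_space x ->
    let u := potential n k alpha beta in
    let Cx := C_infty n k alpha beta /
              normal_coord x `^ (2 - n%:R + beta * (1 - alpha)) in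
    [/\ forall f, f \in Lfun (@lebesgue_tuple R n.-1) +oo%E ->
          forall i, derivable (u f) x (delta_mx 0 i),
        sharp_coefficient n (fun f => enorm (gradient (u f) x)) Cx,
        sharp_coefficient n (fun f => `|normal_derivative (u f) x|) Cx
      & unit_ball_sup n (fun f => `|normal_derivative (u f) x|)
        = unit_ball_sup n (fun f => enorm (gradient (u f) x))].
Proof.
move=> n3; have n0 : (0 < n)%N by exact: leq_trans n3.
rewrite (n_pred n n0) addrK => bd.
split; first exact: exists_unique_alpha_n.
move=> an alpha alpha_n le_an x x0 u Cx.
have al1 : 1 <= alpha by case: alpha_n => /ltW /le_trans an1 _; exact: an1.
have ratio := alpha_n_ratio n beta n0 bd an alpha alpha_n le_an.
have CxE : Cx = `|gradient_scale n k alpha beta x|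
    * kernel_mass n.-1 alpha beta (normal_coord x).
  by rewrite C_inftyE// (n_pred n n0).
have M0 := kernel_mass_ge0 n.-1 alpha beta (normal_coord x) al1 bd.
have Cx0 : 0 <= Cx by rewrite CxE mulr_ge0.
have grad_le f N : f \in Lfun (@lebesgue_tuple R n.-1) +oo%E ->
    ('N[@lebesgue_tuple R n.-1]_+oo [EFin \o f] = N%:E)%E ->
    enorm (gradient (u f) x) <= Cx * N.
  by move=> fL fN; rewrite CxE; exact: enorm_gradient_le.
have normal_le f : `|normal_derivative (u f) x| <= enorm (gradient (u f) x).
  by have := norm_coord_le_enorm _ (gradient (u f) x) (rshift n.-1 0); rewrite mxE.
have normal1 : `|normal_derivative (u (cst 1)) x| = Cx.
  by rewrite normal_derivative_cst1// normrM (ger0_norm M0) CxE.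
have grad1 : enorm (gradient (u (cst 1)) x) = Cx.
  have [f1 N1] := @cst1_Lfun_infty R n.
  (* The normal derivative alone already reaches the upper bound. *)
  apply/eqP; rewrite eq_le -{2}normal1 normal_le andbT.
  by have := grad_le _ 1 f1 N1; rewrite mulr1.
have [sharp_grad sup_grad] := sharp_and_sup_attained_cst1 n _ Cx grad_le grad1 Cx0.
have [sharp_normal sup_normal] := sharp_and_sup_attained_cst1 n _ Cx
  (fun f N fL fN => le_trans (normal_le f) (grad_le f N fL fN)) normal1 Cx0.
split=> //; last by rewrite sup_normal sup_grad.
move=> f fL i; have [] // := is_derive_potential n k alpha beta f x (delta_mx 0 i) x0 bd fL.
Qed.
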